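(* Let $\Upsilon$ be the map from $]-\gamma_0,-1[$ to $]-\infty,-\gamma_0]$ such that $$d^{*}(l_x,x)=\phi^{n+1}\Big(d^{*}\big(l_{\Upsilon(x)},\Upsilon(x)\big)\Big)\quad\text{if } x\in\,]-\gamma_n,-\gamma_{n+1}],\ n\in\mathbb{N}.$$ The map $\Upsilon$ is onto. For each $n\in\mathbb{N}$, its restriction from $]-\gamma_n,-\gamma_{n+1}]$ into $]-\infty,-\gamma_0]$ is one to one and continuous.
   Context: $\mathbb{N}=\{0,1,2,\dots\}$; $l(w)$ is the length of a word $w$. For a real $\beta<-1$: $l_\beta=\frac{\beta}{1-\beta}$, $r_\beta=\frac{1}{1-\beta}$, $I_\beta=[l_\beta,r_\beta)$, $T_\beta:I_\beta\to I_\beta$, $T_\beta(y)=\beta y-\lfloor\beta y-l_\beta\rfloor$. The $\beta$-expansion of $l_\beta$ is $d(l_\beta,\beta)=(d_i^* )_{i\ge1}$ with $d_i^*=\lfloor\beta T_\beta^{i-1}(l_\beta)-l_\beta\rfloor$. The characteristic sequence $d^*(l_\beta,\beta)$ is the infinite repetition of $d_1^*\cdots d_{2p-2}^*(d_{2p-1}^*-1)0$ if $(d_i^* )$ is purely periodic with odd minimal period $2p-1$, and is $(d_i^* )_{i\ge1}$ otherwise. $\phi$ is the morphism on words and sequences over $\mathbb{N}$ with $\phi(k)=1(00)^k$ ($1$ followed by $2k$ zeros), and $\phi^n$ is its $n$-th iterate. $u_{-1}=0$, and for $n\in\mathbb{N}$, $u_n=\phi^n(1)$, $v_n=\phi^n(00)=u_{n-1}u_{n-1}$.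 $\gamma_n$ is the positive real number such that $1=\gamma_n^{-l(u_n)}+\gamma_n^{-l(v_n)}$; in particular $\gamma_0=\frac{1+\sqrt5}{2}$. The sequence $(\gamma_n)$ decreases to $1$, so each $x\in\,]-\gamma_0,-1[$ lies in exactly one interval $]-\gamma_n,-\gamma_{n+1}]$, and for such $x$ there is a unique real number $y\in\,]-\infty,-\gamma_0]$ with $d^*(l_x,x)=\phi^{n+1}(d^*(l_y,y))$; $\Upsilon(x)$ is this $y$. *)

(* Defs.v *)
(* MathComp + MathComp-Analysis. *)
From HB Require Import structures.
From mathcomp Require Import all_boot all_order all_algebra.
From mathcomp Require Import all_classical all_reals all_analysis.
Import Order.TTheory GRing.Theory Num.Theory.
Import numFieldNormedType.Exports.

Set Implicit Arguments.
Unset Strict Implicit.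
Unset Printing Implicit Defensive.

Local Open Scope classical_set_scope.
Local Open Scope ring_scope.

(* All sequences over nat are indexed from 0: d_(i+1) is stored at index i. *)

Definition lb (R : realType) (b : R) : R := b / (1 - b).

Definition Tb (R : realType) (b y : R) : R :=
  b * y - (Num.floor (b * y - lb b))%:~R.

(* For b < -1, every iterate of Tb b at lb b lies in [lb b, (1 - b)^-1[, where
   b * y - lb b > 0; hence the floor below is nonnegative and `| | only
   performs the conversion from int to nat. *)
Definition expansion (R : realType) (b : R) (i : nat) : nat :=
  `|Num.floor (b * iter i (Tb b) (lb b) - lb b)|%N.

Definition is_period (s : nat -> nat) (p : nat) : Prop :=
  (0 < p)%N /\ forall i, s (i + p)%N = s i.

Definition is_min_period (s : nat -> nat) (p : nat) : Prop :=
  is_period s p /\ forall q, is_period s q -> (p <= q)%N.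

(* (s_1 ... s_(p-1) (s_p - 1) 0)^oo, a repetition of a word of length p + 1. *)
Definition odd_correction (s : nat -> nat) (p : nat) (i : nat) : nat :=
  let j := (i %% p.+1)%N in
  if j == p then 0%N else if j == p.-1 then (s j).-1 else s j.

Definition charseq (R : realType) (b : R) : nat -> nat :=
  let s := expansion b in
  match pselect (exists p, odd p /\ is_min_period s p) with
  | left e => odd_correction s (projT1 (cid e))
  | right _ => s
  end.

Definition phi_word (w : seq nat) : seq nat :=
  flatten [seq 1%N :: nseq k.*2 0%N | k <- w].

(* Each letter has a nonempty image, so the image of the prefix of length i + 1
   determines the letter of index i of the image of s. *)
Definition phi_seq (s : nat -> nat) (i : nat) : nat :=
  nth 0%N (phi_word (mkseq s i.+1)) i.

Definition u_ (n : nat) : seq nat := iter n phi_word [:: 1%N].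

Definition v_ (n : nat) : seq nat := iter n phi_word [:: 0%N; 0%N].

Definition gamma_ (R : realType) (n : nat) : R :=
  xget 0 [set g : R | 0 < g /\ 1 = g ^- size (u_ n) + g ^- size (v_ n)].

(* ]-gamma_n, -gamma_(n+1)] *)
Definition J_ (R : realType) (n : nat) : set R :=
  `] - gamma_ R n, - gamma_ R n.+1]%classic.

Definition Upsilon (R : realType) (x : R) : R :=
  xget 0 [set y : R | y \in `]-oo, - gamma_ R 0] /\
    exists2 n : nat, J_ n x & charseq x =1 iter n.+1 phi_seq (charseq y)].

(* Main.v *)
Require Import Defs.
From HB Require Import structures.
From mathcomp Require Import all_boot all_order all_algebra.
From mathcomp Require Import all_classical all_reals all_analysis.
From mathcomp Require Import ring lra zify.
Import Order.TTheory GRing.Theory Num.Theory.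
Import numFieldNormedType.Exports.
Set Implicit Arguments.
Unset Strict Implicit.
Unset Printing Implicit Defensive.
Local Open Scope classical_set_scope.
Local Open Scope ring_scope.

(** Put z = -1/b and measure the orbit of l_b from the left end of the interval:
    tau_i = T^i(l_b) - l_b.  Then tau_0 = 0 and tau_i = 1 - z (d_i + tau_(i+1)),
    so that the expansion is the itinerary of 0 under decreasing affine branches
    that tile [0, 1].  A value 0 may also be read as the value 1 of the previous
    branch; the correction that turns the expansion into the characteristic
    sequence is the choice of the value 0 at even indices and of the value 1 at
    odd ones, that is, of the limit of the itineraries of small positive points.
    This choice is [kneads].

    The proof embeds the original family in a family with two parameters x and y,
    whose branch of index d has slope - x y^d; the original one is (z, 1).  The
    tails of phi(k) for the parameters (x, y) are affine images of the tails of k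
    for the parameters (x y, x^2) ([kneads_phi]).  As |u_(n+1)| = |u_n| + |v_n|
    and |v_(n+1)| = 2 |u_n|, iteration shows that phi^(n+1) turns the kneading
    sequence for (z^|u_n|, z^|v_n|) into the characteristic sequence of -1/z.
    The interval ]-gamma_n, -gamma_(n+1)] is given by x + y > 1 >= x (x + y) for
    these x and y, and ]-oo, -gamma_0] by the same inequalities for (z, 1): both
    are instances of [cell].

    Two facts, valid at every level, then give the theorem.  On a cell the kneading
    sequence is a strictly increasing function of z for the alternating order
    ([kneads_mono]).  And all cells produce the same sequences ([cell_transfer]).
    Hence Upsilon restricted to ]-gamma_n, -gamma_(n+1)] is the composition of the
    increasing bijection of one cell with the inverse of that of another one: an
    increasing map onto an interval, thus one to one and continuous.

    The inequality x (x + y) <= 1 is what makes everything work.  Inside a cell,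
    [selfmin_value_bounds] and [zero_transfer] compare an extremal value over all
    tails with x (x + y) times itself; in [kneads_mono] the inequality makes the
    first gap between two orbits large enough to persist.  For (z, 1) it says that
    -b is at least the golden ratio; closer to -1 these arguments break down for
    the original family, and the larger values of (|u_n|, |v_n|) take over. *)

(** * Sequences, branches and itineraries *)

(** The infimum L of f satisfies c L <= L, hence L >= 0.  A bound
    on all tails of an infinite sequence thus only requires to improve an arbitrary
    nonpositive lower bound by a factor c < 1. *)
Lemma contraction_ge0 (R : realType) (f : nat -> R) (c : R) :
  c < 1 -> (exists B, forall i, B <= f i) ->
  (forall L, L <= 0 -> (forall i, L <= f i) -> forall i, c * L <= f i) ->
  forall i, 0 <= f i.
Proof.
move=> c1 [B fB] step.
have fne : range f !=set0 by exists (f 0%N), 0%N.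
have flb : has_lbound (range f) by exists B => _ [i _ <-].
set L := inf (range f).
have Lf i : L <= f i by apply: ge_inf => //; exists i.
have [L0|L0 i] := ltP L 0; last exact: le_trans (Lf i).
have : c * L <= L.
  by apply: lb_le_inf => // _ [i _ <-]; apply: step => //; exact: ltW.
nra.
Qed.

Definition shiftn (k : nat -> nat) (i : nat) : nat -> nat := fun j => k (i + j)%N.

(** The order in which itineraries under decreasing maps reflect the order of the
    points.  Indices start at 0, so a larger first digit means a smaller point. *)
Definition altlt (k l : nat -> nat) : Prop :=
  exists2 j, (forall i, (i < j)%N -> k i = l i) &
             if odd j then (k j < l j)%N else (l j < k j)%N.

Lemma altlt_total (k l : nat -> nat) : k =1 l \/ altlt k l \/ altlt l k.
Proof.
have [e|/existsNP[i0 /eqP ne0]] := pselect (k =1 l); [by left|right].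
have ex : exists i, k i != l i by exists i0.
have agree i : (i < ex_minn ex)%N -> k i = l i.
  case: ex_minnP => m _ mmin im; apply/eqP; apply: contraTT im => /mmin.
  by rewrite -leqNgt.
have := @erefl _ (ex_minn ex); case: {2}_ / ex_minnP => m ne _ em.
rewrite em in agree.
have [lt|gt|e] := ltngtP (k m) (l m); last by rewrite e eqxx in ne.
- by case om: (odd m); [left|right]; exists m; rewrite ?om // => i /agree.
- by case om: (odd m); [right|left]; exists m; rewrite ?om // => i /agree.
Qed.

Lemma altlt_asym (k l : nat -> nat) : altlt k l -> ~ altlt l k.
Proof.
move=> [i ai di] [j aj dj]; have [ij|ji|ij] := ltngtP i j.
- by move: di; rewrite (aj _ ij); case: ifP; rewrite ltnn.
- by move: dj; rewrite (ai _ ji); case: ifP; rewrite ltnn.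
- by move: di dj; rewrite ij; case: ifP => _; lia.
Qed.

Definition slope (R : realType) (x y : R) (d : nat) : R := x * y ^+ d.

(** The value at 0 of the branch of index d.  The branch takes the value of the
    next peak at 1 ([branch1]), so that consecutive branches leave no gap. *)
Definition peak (R : realType) (x y : R) (d : nat) : R :=
  1 - \sum_(i < d) slope x y i.

Definition branch (R : realType) (x y : R) (d : nat) (t : R) : R :=
  peak x y d - slope x y d * t.

Definition itinerary (R : realType) (x y : R) (k : nat -> nat) (t : nat -> R) :=
  forall i, t i = branch x y (k i) (t i.+1).

(** The parity condition selects one of the two digits available at each end
    point shared by two branches: the itinerary is that of 0 approached from
    above, and the branches reverse the orientation at each step. *)
Definition kneads (R : realType) (x y : R) (k : nat -> nat) (t : nat -> R) :=
  [/\ t 0%N = 0, itinerary x y k t &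
      forall i, if odd i then 0 < t i <= 1 else 0 <= t i < 1].

Section Basic.
Variables (R : realType).
Implicit Types (x y s t L : R) (d : nat).

Lemma peak0 x y : peak x y 0 = 1.
Proof. by rewrite /peak big_ord0 subr0. Qed.

Lemma peakS x y d : peak x y d.+1 = peak x y d - slope x y d.
Proof. by rewrite /peak big_ord_recr /= opprD addrA. Qed.

Lemma branch1 x y d : branch x y d 1 = peak x y d.+1.
Proof. by rewrite /branch mulr1 peakS. Qed.

Lemma slopeS x y d : slope x y d.+1 = slope x y d * y.
Proof. by rewrite /slope exprSr mulrA. Qed.

Lemma slope_ge0 x y d : 0 <= x -> 0 <= y -> 0 <= slope x y d.
Proof. by move=> x0 y0; rewrite mulr_ge0 // exprn_ge0. Qed.

Lemma slope_gt0 x y d : 0 < x -> 0 < y -> 0 < slope x y d.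
Proof. by move=> x0 y0; rewrite mulr_gt0 // exprn_gt0. Qed.

Lemma slope_le x y d : 0 <= x -> 0 <= y -> y <= 1 -> slope x y d <= x.
Proof. by move=> x0 y0 y1; rewrite ler_piMr // exprn_ile1. Qed.

Lemma slope_anti x y d d' : 0 <= x -> 0 <= y -> y <= 1 -> (d <= d')%N ->
  slope x y d' <= slope x y d.
Proof. by move=> x0 y0 y1 dd; rewrite ler_wpM2l // ler_wiXn2l. Qed.

Lemma peak_anti x y d d' : 0 <= x -> 0 <= y -> (d <= d')%N ->
  peak x y d' <= peak x y d.
Proof.
move=> x0 y0 /subnK <-; elim: (d' - d)%N => // n IHn.
by rewrite addSn peakS; apply: le_trans IHn; rewrite gerBl slope_ge0.
Qed.

Lemma peak_lt x y d d' : 0 < x -> 0 < y -> (d < d')%N ->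
  peak x y d' < peak x y d.
Proof.
move=> x0 y0 dd; apply: le_lt_trans (peak_anti (ltW x0) (ltW y0) dd) _.
by rewrite peakS gtrBl slope_gt0.
Qed.

Lemma peak_le1 x y d : 0 <= x -> 0 <= y -> peak x y d <= 1.
Proof. by move=> x0 y0; rewrite -(peak0 x y); exact: peak_anti. Qed.

Lemma branch_le1 x y d t : 0 <= x -> 0 <= y -> 0 <= t -> branch x y d t <= 1.
Proof.
move=> x0 y0 t0; apply: le_trans (peak_le1 d x0 y0).
by rewrite gerBl mulr_ge0 // slope_ge0.
Qed.

(** The bound 1 - x L for the tails is the one that the recursion provides from
    the lower bound L.  A loss of L at the two ends of the gap between branches
    costs slope_d (x + y) L altogether, which is where x (x + y) comes from. *)
Lemma branch_gap x y L d d' s s' : 0 < x -> 0 < y -> y <= 1 -> L <= 0 ->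
  (d < d')%N -> s <= 1 - x * L -> L <= s' ->
  x * (x + y) * L <= branch x y d s - branch x y d' s'.
Proof.
move=> x0 y0 y1 L0 dd sL s'L.
have q0 := slope_gt0 d x0 y0; have q'0 := slope_gt0 d' x0 y0.
have := peak_anti (ltW x0) (ltW y0) dd; rewrite peakS.
have := slope_anti (ltW x0) (ltW y0) y1 dd; rewrite slopeS.
have := slope_le d (ltW x0) (ltW y0) y1.
rewrite /branch; move: (slope x y d) (slope x y d') q0 q'0 => q q' q0 q'0 qx q'q tt.
have h1 : q * s <= q * (1 - x * L) by rewrite ler_wpM2l // ltW.
have h2 : q' * L <= q' * s' by rewrite ler_wpM2l // ltW.
have h3 : q * y * L <= q' * L by rewrite ler_wnM2r.
have h4 : x * ((x + y) * L) <= q * ((x + y) * L).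
  by apply: ler_wnM2r => //; rewrite mulr_ge0_le0 // addr_ge0 // ltW.
lra.
Qed.
End Basic.

(** * Comparison of itineraries *)

Definition weight (R : realType) (x y : R) (k : nat -> nat) (j : nat) : R :=
  \prod_(i < j) slope x y (k i).

(** Kneading sequences have this property because 0 is the least point. *)
Definition selfmin (k : nat -> nat) : Prop := forall i, ~ altlt (shiftn k i) k.

(** The kneading sequence at the right end x (x + y) = 1 of a cell. *)
Definition one_zeros (i : nat) : nat := (i == 0)%N.

Section Compare.
Variables (R : realType).
Implicit Types (x y s L : R) (d : nat) (t : nat -> R) (k : nat -> nat).

Lemma itinerary_shift x y k t i : itinerary x y k t ->
  itinerary x y (shiftn k i) (fun j => t (i + j)%N).
Proof. by move=> kt j; rewrite addnS; exact: kt. Qed.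

(** Applying a common prefix of digits is an affine map whose slope is, up to the
    sign, the product of the slopes met. *)
Lemma prefix_gap x y k k' t t' j :
  itinerary x y k t -> itinerary x y k' t' ->
  (forall i, (i < j)%N -> k i = k' i) ->
  t' 0%N - t 0%N = (-1) ^+ j * weight x y k j * (t' j - t j).
Proof.
move=> kt kt'; elim: j => [|j IHj] agree.
  by rewrite /weight big_ord0 mulr1 mul1r.
rewrite IHj => [|i ij]; last by apply: agree; exact: ltnW.
rewrite kt kt' /branch -(agree j) // /weight big_ord_recr /= exprS; ring.
Qed.

Lemma weight_gt0 x y k j : 0 < x -> 0 < y -> 0 < weight x y k j.
Proof. by move=> x0 y0; apply: prodr_gt0 => i _; exact: slope_gt0. Qed.

Lemma weight_le1 x y k j : 0 < x -> x < 1 -> 0 < y -> y <= 1 ->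
  weight x y k j <= 1.
Proof.
move=> x0 x1 y0 y1; apply: prodr_ile1 => i _.
rewrite (slope_ge0 _ (ltW x0) (ltW y0)) /=; apply: le_trans (ltW x1).
by apply: slope_le => //; exact: ltW.
Qed.

(** Both parities of the first difference lead to the same picture: the larger
    point uses the branch of smaller index. *)
Lemma altlt_gap k k' : altlt k k' -> exists j,
  [/\ odd j, (k j < k' j)%N & forall x y t t', 0 < x -> x < 1 -> 0 < y -> y <= 1 ->
     itinerary x y k t -> itinerary x y k' t' ->
     exists2 q, 0 < q <= 1 & t' 0%N - t 0%N =
       q * (branch x y (k j) (t j.+1) - branch x y (k' j) (t' j.+1))] \/
  [/\ ~~ odd j, (k' j < k j)%N & forall x y t t', 0 < x -> x < 1 -> 0 < y -> y <= 1 ->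
     itinerary x y k t -> itinerary x y k' t' ->
     exists2 q, 0 < q <= 1 & t' 0%N - t 0%N =
       q * (branch x y (k' j) (t' j.+1) - branch x y (k j) (t j.+1))].
Proof.
move=> [j agree b]; exists j; move: b; case: ifP => oj kj; [left|right]; split => //.
- move=> x y t t' x0 x1 y0 y1 kt kt'; exists (weight x y k j).
    by rewrite weight_gt0 //= weight_le1.
  rewrite (prefix_gap kt kt' agree) -signr_odd oj expr1 -kt -kt'; ring.
- move=> x y t t' x0 x1 y0 y1 kt kt'; exists (weight x y k j).
    by rewrite weight_gt0 //= weight_le1.
  rewrite (prefix_gap kt kt' agree) -signr_odd oj expr0 -kt -kt'; ring.
Qed.

Lemma altlt_cmp x y L k k' t t' : 0 < x -> x < 1 -> 0 < y -> y <= 1 -> L <= 0 ->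
  itinerary x y k t -> itinerary x y k' t' ->
  (forall i, L <= t i <= 1 - x * L) -> (forall i, L <= t' i <= 1 - x * L) ->
  altlt k k' -> x * (x + y) * L <= t' 0%N - t 0%N.
Proof.
move=> x0 x1 y0 y1 L0 kt kt' tL t'L /altlt_gap[j].
have c0 : x * (x + y) * L <= 0.
  by rewrite mulr_ge0_le0 // mulr_ge0 ?addr_ge0 // ltW.
have pos (q z : R) : 0 < q <= 1 -> x * (x + y) * L <= z -> x * (x + y) * L <= q * z.
  move=> /andP[q0 q1] cz; apply: le_trans (_ : q * (x * (x + y) * L) <= _).
    by move: c0; set c := (_ * L) => c0; nra.
  by rewrite ler_pM2l.
case=> -[oj kj /(_ x y t t' x0 x1 y0 y1 kt kt')[q q01 ->]]; apply: pos => //.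
- have /andP[_ ?] := tL j.+1; have /andP[? _] := t'L j.+1; exact: branch_gap.
- have /andP[? _] := tL j.+1; have /andP[_ ?] := t'L j.+1; exact: branch_gap.
Qed.

(** Consecutive branches share an end point and no other point. *)
Lemma branch_meet x y d d' s s' : 0 < x -> 0 < y -> (d < d')%N -> s <= 1 -> 0 <= s' ->
  branch x y d s <= branch x y d' s' -> [/\ d' = d.+1, s = 1 & s' = 0].
Proof.
move=> x0 y0 dd s1 s'0 le.
have q0 := slope_gt0 d x0 y0; have q'0 := slope_gt0 d' x0 y0.
have qs : slope x y d * s <= slope x y d by rewrite ler_piMr // ltW.
have qs' : 0 <= slope x y d' * s' by rewrite mulr_ge0 // ltW.
have e : d' = d.+1.
  apply/eqP; rewrite eqn_leq dd andbT leqNgt; apply/negP => /(peak_lt x0 y0).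
  by move: le; rewrite peakS /branch; lra.
subst d'; move: le; rewrite /branch peakS => le; split => //.
- have : slope x y d * (1 - s) <= 0 by lra.
  by rewrite pmulr_rle0 //; lra.
- have : slope x y d.+1 * s' <= 0 by lra.
  by rewrite pmulr_rle0 //; lra.
Qed.

Lemma branch_eq1 x y d s : 0 < x -> x < 1 -> 0 < y -> 0 <= s ->
  branch x y d s = 1 -> d = 0%N /\ s = 0.
Proof.
move=> x0 x1 y0 s0; case: d => [|d] e.
  split => //; move: e; rewrite /branch peak0 /slope expr0 mulr1 => e.
  have /eqP : x * s = 0 by lra.
  by rewrite mulf_eq0 gt_eqF //= => /eqP.
have := peak_lt x0 y0 (ltn0Sn d); rewrite peak0 => tl.
have := mulr_ge0 (ltW (slope_gt0 d.+1 x0 y0)) s0.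
by move: e; rewrite /branch; lra.
Qed.

Lemma kneads_bounds x y k t : kneads x y k t -> forall i, 0 <= t i <= 1.
Proof. by case=> _ _ p i; have := p i; case: odd; lra. Qed.

Lemma kneads_bounds0 x y k t : kneads x y k t -> forall i, 0 <= t i <= 1 - x * 0.
Proof. by move=> kt i; rewrite mulr0 subr0; exact: kneads_bounds kt i. Qed.

Lemma kneads_odd x y k t i : kneads x y k t -> odd i -> 0 < t i.
Proof. by case=> _ _ p oi; have := p i; rewrite oi => /andP[]. Qed.

Lemma kneads_even x y k t i : kneads x y k t -> ~~ odd i -> t i < 1.
Proof. by case=> _ _ p oi; have := p i; rewrite (negbTE oi) => /andP[]. Qed.

Lemma itinerary_uniq x y k t t' : 0 <= x -> x < 1 -> 0 <= y -> y <= 1 ->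
  itinerary x y k t -> itinerary x y k t' ->
  (exists B, forall i, `|t i - t' i| <= B) -> t =1 t'.
Proof.
move=> x0 x1 y0 y1 kt kt' [B tB] i; apply/eqP; rewrite -subr_eq0 -normr_le0 -oppr_ge0.
apply: (@contraction_ge0 _ (fun i => - `|t i - t' i|) x) => //.
  by exists (- B) => j; rewrite lerN2.
move=> L L0 tL j; rewrite kt kt' /branch.
have -> : peak x y (k j) - slope x y (k j) * t j.+1 -
  (peak x y (k j) - slope x y (k j) * t' j.+1) =
  - (slope x y (k j) * (t j.+1 - t' j.+1)) by ring.
rewrite normrN normrM (ger0_norm (slope_ge0 _ x0 y0)).
have := tL j.+1; have := slope_le (k j) x0 y0 y1; have := slope_ge0 (k j) x0 y0.
have := normr_ge0 (t j.+1 - t' j.+1); move: (slope _ _ _) `|_| => q n; nra.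
Qed.

(** A smaller tail would have value 0 as well, so that the two sequences would
    first differ by the two codings of one end point, and the parity condition
    forbids the smaller coding. *)
Lemma kneads_selfmin x y k t : 0 < x -> x < 1 -> 0 < y -> y <= 1 ->
  kneads x y k t -> selfmin k.
Proof.
move=> x0 x1 y0 y1 K i lt; have [t0 kt _] := K.
have := kneads_bounds K; have kti := itinerary_shift i kt => tb.
have ti0 : t i = 0.
  have := altlt_cmp x0 x1 y0 y1 (lexx 0) kti kt
    (fun j => kneads_bounds0 K (i + j)) (kneads_bounds0 K) lt.
  rewrite /= t0 mulr0 addn0.
  by have /andP[] := tb i; lra.
have ei : ~~ odd i by apply/negP => /(kneads_odd K); rewrite ti0 ltxx.
move: lt => /altlt_gap[j]; rewrite /shiftn.
case=> -[oj kj /(_ x y _ _ x0 x1 y0 y1 kti kt)[q /andP[q0 _]]].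
all: rewrite addn0 t0 ti0 subrr => /esym/eqP; rewrite mulf_eq0 gt_eqF //= subr_eq0.
all: move=> /eqP; rewrite -?addnS => e.
- have /andP[_ b1] := tb (i + j.+1)%N; have /andP[b2 _] := tb j.+1.
  have [|_ t1 _] := branch_meet x0 y0 kj b1 b2; first by rewrite e.
  have : t (i + j.+1)%N < 1 by apply: (kneads_even K); rewrite oddD oddS oj (negbTE ei).
  by rewrite t1 ltxx.
- have /andP[_ b1] := tb j.+1; have /andP[b2 _] := tb (i + j.+1)%N.
  have [|_ _ t1] := branch_meet x0 y0 kj b1 b2; first by rewrite e.
  have : 0 < t (i + j.+1)%N by apply: (kneads_odd K); rewrite oddD oddS (negbTE ei).
  by rewrite t1 ltxx.
Qed.

(** The fixed point 1/(1 + x) of the branch of index 0, after the first digit. *)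
Definition one_zeros_tail x y (i : nat) : R :=
  if i is 0%N then (1 - x * (x + y)) / (1 + x) else (1 + x)^-1.

Lemma one_zeros_itinerary x y : 0 < x -> itinerary x y one_zeros (one_zeros_tail x y).
Proof.
move=> x0 [|i] /=; rewrite /branch /= ?peakS peak0 /slope ?expr0 ?expr1; field; lra.
Qed.

(** The sequence 1000... starts from a nonnegative point when x (x + y) <= 1, and
    its later tails are interior to [0, 1], hence no coding is ambiguous. *)
Lemma kneads_le_one_zeros x y k t : 0 < x -> x < 1 -> 0 < y -> y <= 1 ->
  x * (x + y) <= 1 -> kneads x y k t -> ~ altlt one_zeros k.
Proof.
move=> x0 x1 y0 y1 xy K lt; have [t0 kt _] := K.
have et := one_zeros_itinerary y x0.
have x1i : 0 < (1 + x)^-1 < 1.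
  by rewrite invr_gt0 invf_lt1; lra.
have e0 : 0 <= one_zeros_tail x y 0 by rewrite /= mulr_ge0 ?subr_ge0 // ltW; lra.
have eb i : 0 <= one_zeros_tail x y i <= 1.
  case: i => [|i] /=; last lra.
  rewrite -[upow in upow && _]/(0 <= one_zeros_tail x y 0) e0 /= ler_pdivrMr; nra.
have tb := kneads_bounds K.
case/altlt_gap: lt => j; case=> -[oj kj /(_ x y _ _ x0 x1 y0 y1 et kt)[q /andP[q0 _]]].
all: rewrite t0 sub0r => g.
all: have /andP[b0 b1] := tb j.+1; have /andP[c0 c1] := eb j.+1.
- have le : branch x y (one_zeros j) (one_zeros_tail x y j.+1) <=
            branch x y (k j) (t j.+1).
    by rewrite -subr_le0 -(pmulr_rle0 _ q0) -g oppr_le0.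
  by have [_ /= e _] := branch_meet x0 y0 kj c1 b0 le; lra.
- have le : branch x y (k j) (t j.+1) <=
            branch x y (one_zeros j) (one_zeros_tail x y j.+1).
    by rewrite -subr_le0 -(pmulr_rle0 _ q0) -g oppr_le0.
  by have [_ _ /= e] := branch_meet x0 y0 kj b1 c0 le; lra.
Qed.

Lemma one_zeros_kneads x y : 0 < x -> x * (x + y) = 1 ->
  kneads x y one_zeros (one_zeros_tail x y).
Proof.
move=> x0 xy; split; first by rewrite /= xy subrr mul0r.
  exact: one_zeros_itinerary.
have x1i : 0 < (1 + x)^-1 < 1 by rewrite invr_gt0 invf_lt1; lra.
by case=> [|i] /=; [rewrite xy subrr mul0r; lra|case: ifP; lra].
Qed.

Lemma kneads_uniq x y k k' t t' : 0 < x -> 0 < y ->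
  kneads x y k t -> kneads x y k' t' -> k =1 k' /\ t =1 t'.
Proof.
move=> x0 y0 K K'.
have step i : t i = t' i -> k i = k' i /\ t i.+1 = t' i.+1.
  move=> e; have [_ kt p] := K; have [_ kt' p'] := K'.
  have := kt i; rewrite e kt' => eb.
  have bt := kneads_bounds K i.+1; have bt' := kneads_bounds K' i.+1.
  have kk : k i = k' i.
    have := p i.+1; have := p' i.+1.
    have [lt|gt|//] := ltngtP (k i) (k' i).
    - have [|||_ -> ->] := @branch_meet x y _ _ (t i.+1) (t' i.+1) x0 y0 lt.
      + lra.
      + lra.
      + by rewrite eb.
      + by case: (odd i.+1); rewrite ?ltxx ?andbF.
    - have [|||_ -> ->] := @branch_meet x y _ _ (t' i.+1) (t i.+1) x0 y0 gt.
      + lra.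
      + lra.
      + by rewrite eb.
      + by case: (odd i.+1); rewrite ?ltxx ?andbF.
  split => //; move: eb; rewrite kk /branch => /addrI/oppr_inj.
  by move/(mulfI (lt0r_neq0 (slope_gt0 (k' i) x0 y0))).
have tt i : t i = t' i.
  elim: i => [|i /step[]//]; by case: K => ->; case: K' => ->.
by split => // i; have [] := step i (tt i).
Qed.
End Compare.

(** * Monotonicity of the kneading sequence *)

Section Monotone.
Variable R : realType.
Implicit Types (x y s : R) (d : nat) (t : nat -> R) (k : nat -> nat).

Lemma selfmin_digit k i : selfmin k -> (k i <= k 0)%N.
Proof.
move=> m; rewrite leqNgt; apply/negP => lt.
by apply: (m i); exists 0%N => //=; rewrite /shiftn addn0.
Qed.

Lemma kneads_digit0 x y k t : 0 < x -> x < 1 -> kneads x y k t -> (0 < k 0)%N.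
Proof.
move=> x0 x1 K; have [t0 kt _] := K; rewrite lt0n; apply/eqP => k0.
have /andP[a b] := kneads_bounds K 1.
by have := kt 0%N; rewrite t0 k0 /branch peak0 /slope expr0; nra.
Qed.

Lemma sum_pow_le y y' d : 0 <= y -> y <= y' ->
  \sum_(i < d) y ^+ i <= \sum_(i < d) y' ^+ i.
Proof. by move=> y0 yy; apply: ler_sum => i _; apply: lerXn2r; rewrite ?nnegrE //; lra. Qed.

(** When x and y grow, a branch loses its distance to 1 multiplied by x'/x - 1,
    and a remainder which grows with d and s. *)
Lemma branch_drop x y x' y' d s : 0 < x ->
  branch x y d s - branch x' y' d s =
  x' * (\sum_(i < d) y' ^+ i - \sum_(i < d) y ^+ i + (y' ^+ d - y ^+ d) * s) +
  (x' / x - 1) * (1 - branch x y d s).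
Proof.
move=> x0; rewrite /branch /peak /slope -!mulr_sumr.
by move: (\sum_(i < d) y ^+ i) (\sum_(i < d) y' ^+ i) => a b; field; lra.
Qed.

Lemma branch_drop_ge0 x y x' y' d s : 0 < x -> x <= x' -> 0 <= y -> y <= y' ->
  0 <= s -> branch x' y' d s <= branch x y d s.
Proof.
move=> x0 xx y0 yy s0.
rewrite /branch /peak /slope -!mulr_sumr.
have := sum_pow_le d y0 yy.
have : 0 <= \sum_(i < d) y ^+ i by apply: sumr_ge0 => i _; rewrite exprn_ge0.
have : y ^+ d <= y' ^+ d by apply: lerXn2r; rewrite ?nnegrE //; lra.
have : 0 <= y ^+ d by rewrite exprn_ge0.
move: (\sum_(i < d) y ^+ i) (\sum_(i < d) y' ^+ i) (y ^+ d) (y' ^+ d) => a b c e.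
move=> c0 ce a0 ab.
have h1 : x * a <= x' * b by apply: ler_pM => //; lra.
have h2 : x * c <= x' * e by apply: ler_pM => //; lra.
have h3 : x * c * s <= x' * e * s by apply: ler_wpM2r.
lra.
Qed.

(** Hence the loss is largest at the lowest point of the orbit, which is 0, and
    the excess of that loss is at least proportional to the height. *)
Lemma branch_drop_bound x y x' y' d s d0 s0 :
  0 < x -> x <= x' -> 0 <= y -> y <= y' -> 0 <= s <= 1 -> 0 <= s0 ->
  (d <= d0)%N -> (d = d0 -> s <= s0) ->
  branch x y d s - branch x' y' d s <= branch x y d0 s0 - branch x' y' d0 s0
   - (x' / x - 1) * (branch x y d s - branch x y d0 s0).
Proof.
move=> x0 xx y0 yy s01 s00 dd ss; rewrite 2?branch_drop //.
set G := fun d s => \sum_(i < d) y' ^+ i - \sum_(i < d) y ^+ i + (y' ^+ d - y ^+ d) * s.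
rewrite -/(G d s) -/(G d0 s0).
have g i : 0 <= y' ^+ i - y ^+ i by rewrite subr_ge0; apply: lerXn2r; rewrite ?nnegrE //; lra.
suff : G d s <= G d0 s0 by move=> h; have := ler_wpM2l (_ : 0 <= x') h; lra.
have [e|lt] := eqVneq d d0.
  by subst d0; have := ss erefl; have := g d; rewrite /G; nra.
have {}lt : (d < d0)%N by rewrite ltn_neqAle lt.
apply: (@le_trans _ _ (G d.+1 0)).
  by rewrite /G !big_ord_recr /= mulr0 addr0; have := g d; nra.
apply: (@le_trans _ _ (G d0 0)); last by rewrite /G mulr0 lerD2l mulr_ge0.
rewrite -(subnK lt); elim: (d0 - _)%N => // n IHn; apply: le_trans IHn _.
by rewrite /G addSn !big_ord_recr /= !mulr0 !addr0; have := g (n + d.+1)%N; lra.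
Qed.

(** Compare the orbits of 0 for the two parameters as long as the digits agree.
    Let C be the loss of the first branch and K = C / (1 - x'^2).  The difference
    D_i of the tails satisfies q' D_(i+1) = - (N_i + D_i), where the loss N_i lies
    between 0 and C.  As the first digit is at least 1, q' is at most x' y' <=
    1 - x'^2 in the first step, so that D_1 <= - K; from there on D_i <= - K for
    odd i and D_i >= x' K for even i.  These signs decide the first difference in
    favour of [altlt].  If the digits agreed forever, boundedness would give
    D_1 >= - K + rho t_1 with t_1 > 0, a contradiction. *)
Lemma kneads_mono x y x' y' k k' t t' :
  0 < x -> x < x' -> x' < 1 -> 0 < y -> y <= y' -> y' <= 1 ->
  x' * (x' + y') <= 1 ->
  kneads x y k t -> kneads x' y' k' t' -> altlt k k'.
Proof.
move=> x0 xx x'1 y0 yy y'1 xy K K'.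
have [t0 kt _] := K; have [t'0 kt' _] := K'.
have tb := kneads_bounds K; have t'b := kneads_bounds K'.
have x'0 : 0 < x' by lra. have y'0 : 0 < y' by lra.
have kmin := kneads_selfmin x0 (lt_trans xx x'1) y0 (le_trans yy y'1) K.
pose N i := branch x y (k i) (t i.+1) - branch x' y' (k i) (t i.+1).
pose D i := t' i - t i.
pose C := N 0%N.
pose rho := x' / x - 1.
have rho0 : 0 < rho by rewrite subr_gt0 ltr_pdivlMr ?mul1r.
have N0 i : 0 <= N i.
  rewrite subr_ge0 (branch_drop_ge0 _ x0 (ltW xx) (ltW y0) yy) //.
  by have /andP[] := tb i.+1.
have NC i : N i <= C - rho * t i.
  have := @branch_drop_bound x y x' y' (k i) (t i.+1) (k 0%N) (t 1%N) x0 (ltW xx)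
    (ltW y0) yy (tb i.+1) _ (selfmin_digit i kmin).
  rewrite /C /N -!kt t0 subr0; apply; first by have /andP[] := tb 1%N.
  move=> kk; have /andP[ti _] := tb i; move: ti; rewrite (kt i) kk.
  have := kt 0%N; rewrite t0 /branch.
  by have := slope_gt0 (k 0%N) x0 y0; nra.
have C0 : 0 < C.
  have h := N0 0%N; rewrite /C /N branch_drop // -kt t0 subr0 mulr1.
  apply: ltr_wpDl rho0; rewrite mulr_ge0 ?(ltW x'0) // addr_ge0 //.
    by rewrite subr_ge0 (sum_pow_le _ (ltW y0)).
  rewrite mulr_ge0 //; last by have /andP[] := tb 1%N.
  by rewrite subr_ge0; apply: lerXn2r; rewrite ?nnegrE //; lra.
have x2 : 0 < 1 - x' ^+ 2 by nra.
pose K1 := C / (1 - x' ^+ 2).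
have CK : C = K1 * (1 - x' ^+ 2) by rewrite divfK // lt0r_neq0.
have K10 : 0 < K1 by rewrite divr_gt0.
have q0 i : 0 < slope x' y' (k i) by exact: slope_gt0.
have qx i : slope x' y' (k i) <= x' by apply: slope_le => //; exact: ltW.
have rec i : k i = k' i -> slope x' y' (k i) * D i.+1 = - (N i + D i).
  by move=> kk; rewrite /D /N -(kt i) (kt' i) -kk /branch; ring.
have inv j : (forall i, (i < j)%N -> k i = k' i) ->
    (odd j -> D j <= - K1) /\ (~~ odd j -> (0 < j)%N -> x' * K1 <= D j).
  elim: j => [|j IHj] agree; first by split.
  have {}IHj := IHj (fun i ij => agree i (ltnW ij)).
  have r := rec j (agree j (ltnSn j)); have := q0 j; have := qx j => qx' q0'.
  rewrite /= negbK; have := NC j; have := N0 j.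
  have /andP[tj _] := tb j; have := mulr_ge0 (ltW rho0) tj => rt N0' NC'.
  case: IHj; case: (boolP (odd j)) => oj /= h1 h2; split=> // _.
    move=> _; have {}h1 := h1 isT; rewrite -(ler_pM2l q0') r.
    have : x' * (slope x' y' (k j) * K1) <= x' * (x' * K1).
      by rewrite ler_pM2l // ler_pM2r.
    by move: NC'; rewrite CK; nra.
  rewrite -(ler_pM2l q0') r.
  have [j0|j0] := posnP j.
    subst j; rewrite /D t0 t'0 subr0 addr0 -/C CK mulrN lerN2 mulrC ler_pM2l //.
    have : (slope x' y' (k 0%N) <= slope x' y' 1).
      apply: (slope_anti (ltW x'0) (ltW y'0) y'1).
      exact: kneads_digit0 x0 (lt_trans xx x'1) K.
    by rewrite /slope expr1; nra.
  have {}h2 := h2 isT j0.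
  have : slope x' y' (k j) * K1 <= x' * K1 by rewrite ler_pM2r.
  by lra.
(* For equal sequences, two steps of the recursion contract the distance of the
   odd gaps to - K1 by the factor x'^2, so that no odd gap is below - K1. *)
have [kk|[//|[j agree]]] := altlt_total k k'.
  have inv' j := inv j (fun i _ => kk i).
  have Dodd i : - K1 <= D i.*2.+1.
    rewrite -subr_ge0 opprK.
    apply: (@contraction_ge0 _ (fun i => D i.*2.+1 + K1) (x' ^+ 2)).
    - by rewrite -subr_gt0.
    - exists (-1) => j; rewrite /D; have := tb j.*2.+1; have := t'b j.*2.+1; lra.
    move=> L L0 DL {}i.
    have := DL i.+1; rewrite doubleS => DL'.
    have [D3 _] := inv' i.*2.+3; have := rec _ (kk i.*2.+2); have := N0 i.*2.+2.
    have [_ D2] := inv' i.*2.+2; have := rec _ (kk i.*2.+1); have := NC i.*2.+1.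
    have := D3 ltac:(by rewrite /= odd_double).
    have := D2 ltac:(by rewrite /= odd_double) isT.
    have /andP[tj _] := tb i.*2.+1; have := mulr_ge0 (ltW rho0) tj.
    have := qx i.*2.+1; have := qx i.*2.+2; have := q0 i.*2.+1; have := q0 i.*2.+2.
    move: (D i.*2.+3) DL' (D i.*2.+2) (D i.*2.+1) (N i.*2.+2) (N i.*2.+1).
    move: (slope x' y' (k i.*2.+2)) (slope x' y' (k i.*2.+1)).
    move=> p2 p1 d3 DL' d2 d1 n2 n1 p20 p10 p2x p1x rt d2g d3g n1C r1 n20 r2.
    have h2 : d2 <= x' * (K1 - L).
      have : p2 * - d3 <= x' * (K1 - L) by apply: ler_pM; lra.
      lra.
    have h1 : p1 * d2 <= x' * (x' * (K1 - L)) by apply: ler_pM; nra.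
    by move: n1C; rewrite CK; nra.
  have D3 := Dodd 1%N; have [D1 _] := inv' 1%N.
  have := D1 isT; have := rec _ (kk 1%N); have := rec _ (kk 2%N).
  have := N0 2%N; have := NC 1%N; have t1 := kneads_odd K (isT : odd 1).
  have := mulr_gt0 rho0 t1; have [_ /(_ isT isT) D2] := inv' 2%N.
  move: D2 D3 (q0 1%N) (q0 2%N) (qx 1%N) (qx 2%N).
  move: (D 2%N) (D 3%N) (D 1%N) (N 1%N) (N 2%N).
  move: (slope x' y' (k 1%N)) (slope x' y' (k 2%N)).
  move=> p1 p2 d2 d3 d1 n1 n2 d2g d3g p10 p20 p1x p2x rt n1C n20 r2 r1 d1g.
  have h2 : d2 <= x' * K1.
    have : p2 * - d3 <= x' * K1.
      have : p2 * - d3 <= p2 * K1 by rewrite ler_pM2l //; lra.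
      by have : p2 * K1 <= x' * K1; [rewrite ler_pM2r|lra].
    lra.
  have h1 : p1 * d2 <= x' * (x' * K1) by apply: ler_pM; nra.
  by move: n1C; rewrite CK; nra.
have [odj evj] := inv j (fun i ij => esym (agree i ij)).
have := kt j; have := kt' j => e' e.
have nj : N j = t j - branch x' y' (k j) (t j.+1) by rewrite /N -kt.
have /andP[b0 b1] := tb j.+1; have /andP[b'0 b'1] := t'b j.+1.
case: ifP => oj lt.
  have : x' * (x' + y') * 0 <= branch x' y' (k' j) (t' j.+1) - branch x' y' (k j) (t j.+1).
    by apply: branch_gap => //; rewrite ?mulr0 ?subr0.
  have := odj oj; have := NC j; rewrite mulr0 -e'.
  have := mulr_ge0 (ltW rho0) (andP (tb j)).1; rewrite /D nj => h1 h2 h3 h4.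
  have : 0 < x' ^+ 2 * K1 by rewrite mulr_gt0 // exprn_gt0.
  by move: h2; rewrite CK; lra.
have : x' * (x' + y') * 0 <= branch x' y' (k j) (t j.+1) - branch x' y' (k' j) (t' j.+1).
  by apply: branch_gap => //; rewrite ?mulr0 ?subr0.
rewrite mulr0 -e' => h1.
have [j0|j0] := posnP j.
  by subst j; move: nj C0; rewrite /C => ->; move: h1; rewrite t'0 t0; lra.
have := evj (negbT oj) j0; have := N0 j; rewrite nj /D.
by have := mulr_gt0 x'0 K10; lra.
Qed.
End Monotone.

(** * The value of a sequence of digits *)

Fixpoint approx (R : realType) (x y : R) (k : nat -> nat) (n : nat) : R :=
  if n is m.+1 then branch x y (k 0%N) (approx x y (shiftn k 1) m) else 0.

(** The point that a sequence codes, defined for every bounded sequence of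
    digits; it may lie outside [0, 1]. *)
Definition value (R : realType) (x y : R) (k : nat -> nat) : R :=
  limn (approx x y k).

Section Value.
Variable R : realType.
Implicit Types (x y s : R) (d : nat) (t : nat -> R) (k : nat -> nat).

Lemma peak_ge x y d : 0 <= x -> x <= 1 -> 0 <= y -> y <= 1 -> 1 - d%:R <= peak x y d.
Proof.
move=> x0 x1 y0 y1; elim: d => [|d IHd]; first by rewrite peak0 subr0.
by rewrite peakS -natr1; have := slope_le d x0 y0 y1; lra.
Qed.

Lemma branch_norm x y d (K : nat) s : 0 <= x -> x <= 1 -> 0 <= y -> y <= 1 -> (d <= K)%N ->
  `|branch x y d s| <= K.+1%:R + x * `|s|.
Proof.
move=> x0 x1 y0 y1 dK; apply: le_trans (ler_normB _ _) _; apply: lerD.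
  have := peak_ge d x0 x1 y0 y1; have := peak_le1 d x0 y0.
  have : d%:R <= K%:R :> R by rewrite ler_nat.
  by have := ler0n R d; rewrite ler_norml -natr1; lra.
rewrite normrM (ger0_norm (slope_ge0 _ x0 y0)).
by apply: ler_wpM2r => //; exact: slope_le.
Qed.

Definition value_bound x (K : nat) : R := K.+1%:R / (1 - x).

Lemma value_bound_ge0 x K : x < 1 -> 0 <= value_bound x K.
Proof. by move=> x1; rewrite mulr_ge0 // invr_ge0; lra. Qed.

Lemma value_boundE x K : x < 1 -> K.+1%:R + x * value_bound x K = value_bound x K.
Proof. by move=> x1; rewrite /value_bound; field; lra. Qed.

Lemma approx_norm x y k (K n : nat) : 0 <= x -> x < 1 -> 0 <= y -> y <= 1 ->
  (forall i, (k i <= K)%N) -> `|approx x y k n| <= value_bound x K.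
Proof.
move=> x0 x1 y0 y1; elim: n k => [|n IHn] k kK /=.
  by rewrite normr0 value_bound_ge0.
rewrite -(value_boundE K x1).
apply: (le_trans (branch_norm _ x0 (ltW x1) y0 y1 (kK 0%N))).
by rewrite lerD2l ler_wpM2l // IHn // => i; exact: kK.
Qed.

Lemma approx_cauchy x y k (K n m : nat) : 0 <= x -> x < 1 -> 0 <= y -> y <= 1 ->
  (forall i, (k i <= K)%N) ->
  `|approx x y k n - approx x y k (n + m)| <= x ^+ n * value_bound x K.
Proof.
move=> x0 x1 y0 y1; elim: n k => [|n IHn] k kK.
  by rewrite sub0r normrN add0n expr0 mul1r; exact: approx_norm.
rewrite addSn /= /branch.
set a := approx _ _ _ n; set b := approx _ _ _ (n + m).
have -> : peak x y (k 0%N) - slope x y (k 0%N) * a -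
    (peak x y (k 0%N) - slope x y (k 0%N) * b) = - (slope x y (k 0%N) * (a - b)).
  by ring.
rewrite normrN normrM (ger0_norm (slope_ge0 _ x0 y0)) exprS -mulrA.
by apply: ler_pM; rewrite ?slope_ge0 ?slope_le // IHn // => i; exact: kK.
Qed.

Lemma approx_cvg x y k (K : nat) : 0 <= x -> x < 1 -> 0 <= y -> y <= 1 ->
  (forall i, (k i <= K)%N) -> approx x y k n @[n --> \oo] --> value x y k.
Proof.
move=> x0 x1 y0 y1 kK; suff : cvgn (approx x y k) by [].
apply: cauchy_cvg; apply: cauchy_exP => e e0.
have : x ^+ n * value_bound x K @[n --> \oo] --> 0 * value_bound x K.
  by apply: cvgM; [apply: cvg_expr; rewrite ger0_norm|exact: cvg_cst].
rewrite mul0r => /cvgrPdist_lt/(_ e e0)[n _ /(_ n (leqnn n))] /=.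
rewrite sub0r normrN (ger0_norm (mulr_ge0 (exprn_ge0 _ x0) (value_bound_ge0 K x1))) => nb.
exists (approx x y k n); exists n => // m /= nm; rewrite /ball /=.
by rewrite -(subnKC nm); apply: le_lt_trans nb; exact: approx_cauchy.
Qed.

Lemma value_norm x y k (K : nat) : 0 <= x -> x < 1 -> 0 <= y -> y <= 1 ->
  (forall i, (k i <= K)%N) -> `|value x y k| <= value_bound x K.
Proof.
move=> x0 x1 y0 y1 kK; have c := approx_cvg x0 x1 y0 y1 kK.
rewrite -(cvg_lim _ (cvg_norm c)) //; apply: limr_le.
  by apply/cvg_ex; exists `|value x y k|; exact: cvg_norm.
by apply: nearW => n; exact: approx_norm.
Qed.

Lemma value_step x y k (K : nat) : 0 <= x -> x < 1 -> 0 <= y -> y <= 1 ->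
  (forall i, (k i <= K)%N) ->
  value x y k = branch x y (k 0%N) (value x y (shiftn k 1)).
Proof.
move=> x0 x1 y0 y1 kK; have c := approx_cvg x0 x1 y0 y1 kK.
have c1 : approx x y (shiftn k 1) n @[n --> \oo] --> value x y (shiftn k 1).
  by apply: (approx_cvg x0 x1 y0 y1 (K := K)) => i; exact: kK.
have cS : approx x y k n.+1 @[n --> \oo] --> value x y k by rewrite cvg_shiftS.
apply: cvg_unique cS _ => //.
by apply: cvgB; [exact: cvg_cst|apply: cvgMr; exact: c1].
Qed.

Lemma value_itinerary x y k (K : nat) : 0 <= x -> x < 1 -> 0 <= y -> y <= 1 ->
  (forall i, (k i <= K)%N) -> itinerary x y k (fun i => value x y (shiftn k i)).
Proof.
move=> x0 x1 y0 y1 kK i.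
rewrite (value_step x0 x1 y0 y1 (fun j => kK (i + j)%N : (shiftn k i j <= K)%N)).
rewrite {1}/shiftn addn0; congr (branch _ _ _ (value _ _ _)).
by apply/funext => j; rewrite /shiftn addnA addn1.
Qed.
End Value.

Section Zero.
Variable R : realType.
Implicit Types (x y s : R) (d : nat) (t : nat -> R) (k : nat -> nat).

Lemma shiftn0 k : shiftn k 0 = k.
Proof. by apply/funext => j; rewrite /shiftn add0n. Qed.

(** If all tails are >= L with L <= 0, then they are <= 1 - x L, and since each
    shift of k is at least k, [altlt_cmp] improves L to x (x + y) L. *)
Lemma selfmin_value_bounds x y k : 0 < x -> x < 1 -> 0 < y -> y <= 1 ->
  x * (x + y) < 1 -> selfmin k -> 0 <= value x y k ->
  forall i, 0 <= value x y (shiftn k i) <= 1.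
Proof.
move=> x0 x1 y0 y1 xy km v0.
have kK i := selfmin_digit i km.
pose t i := value x y (shiftn k i).
have kt : itinerary x y k t := value_itinerary (ltW x0) x1 (ltW y0) y1 kK.
have t0 : 0 <= t 0%N by rewrite /t shiftn0.
suff t_ge0 i : 0 <= t i.
  move=> i; rewrite -/(t i) t_ge0 /= kt.
  by apply: branch_le1; rewrite ?t_ge0 //; exact: ltW.
apply: (contraction_ge0 xy) => [|L L0 tL {}i].
  exists (- value_bound x (k 0%N)) => {}i.
  have : `|t i| <= value_bound x (k 0%N).
    by apply: (value_norm (ltW x0) x1 (ltW y0) y1) => j; exact: kK.
  by rewrite ler_norml => /andP[].
have tU j : L <= t j <= 1 - x * L.
  rewrite tL /= kt /branch.
  have := peak_le1 (k j) (ltW x0) (ltW y0); have := slope_ge0 (k j) (ltW x0) (ltW y0).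
  have := slope_le (k j) (ltW x0) (ltW y0) y1; have := tL j.+1; nra.
have c0 : x * (x + y) * L <= 0.
  by rewrite mulr_ge0_le0 // mulr_ge0 ?addr_ge0 // ltW.
have [e|[/km//|lt]] := altlt_total (shiftn k i) k.
  by rewrite /t (_ : shiftn k i = k) ?(le_trans c0) //; exact/funext.
have := altlt_cmp x0 x1 y0 y1 L0 kt (itinerary_shift i kt) tU
  (fun j => tU (i + j)%N) lt.
by rewrite /= addn0; lra.
Qed.

(** On the line x + y = 1 the peaks are the powers of y, so that each branch maps
    [0, 1] into itself with positive values. *)
Lemma value_gt0_degenerate x y k (K : nat) : 0 <= x -> x < 1 -> 0 < y -> y <= 1 ->
  x + y = 1 -> (forall i, (k i <= K)%N) -> 0 < value x y k.
Proof.
move=> x0 x1 y0 y1 xy kK.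
pose t i := value x y (shiftn k i).
have kt : itinerary x y k t := value_itinerary x0 x1 (ltW y0) y1 kK.
have peakE d : peak x y d = y ^+ d.
  elim: d => [|d IHd]; first by rewrite peak0 expr0.
  by rewrite peakS IHd /slope exprSr (_ : x = 1 - y); [ring|lra].
have tE i : t i = y ^+ (k i) * (1 - x * t i.+1).
  by rewrite kt /branch peakE /slope; ring.
have yk i : 0 < y ^+ (k i) <= 1 by rewrite exprn_gt0 //= exprn_ile1 // ltW.
have t_ge0 i : 0 <= t i.
  apply: (@contraction_ge0 _ t (x ^+ 2)) => [||L L0 tL {}i].
  - nra.
  - exists (- value_bound x K) => {}i.
    have : `|t i| <= value_bound x K.
      by apply: (value_norm x0 x1 (ltW y0) y1) => j; exact: kK.
    by rewrite ler_norml => /andP[].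
  rewrite tE; have := yk i; have := tE i.+1; have := yk i.+1; have := tL i.+2.
  move: (y ^+ _) (y ^+ _) => a b h1 /andP[a0 a1] h2 /andP[b0 b1].
  have h3 : t i.+1 <= 1 - x * L.
    rewrite h2; have : x * L <= x * t i.+2 by rewrite ler_wpM2l.
    have : x * L <= 0 by rewrite mulr_ge0_le0.
    by nra.
  have h4 : x ^+ 2 * L <= 1 - x * t i.+1.
    by have : x * t i.+1 <= x * (1 - x * L); [rewrite ler_wpM2l|nra].
  have h5 : x ^+ 2 * L <= 0 by rewrite mulr_ge0_le0 // exprn_ge0.
  by nra.
have t1 : t 1%N <= 1 by rewrite kt branch_le1 // ltW.
have := tE 0%N; rewrite /t shiftn0 => ->; rewrite mulr_gt0 //.
  by have /andP[] := yk 0%N.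
by have := t_ge0 1%N; rewrite -/(t 1%N); nra.
Qed.

(** The first term of the bound vanishes at the right end of a cell, whereas the
    second one does not: slightly before that end the value is negative. *)
Lemma value_lt_one_zeros x y k t j : 0 < x -> x < 1 -> 0 < y -> y <= 1 ->
  itinerary x y k t -> (forall i, 0 <= t i) -> ~~ odd j ->
  (forall i, (i < j)%N -> k i = one_zeros i) -> (one_zeros j < k j)%N ->
  t 0%N * (1 + x) <= 1 - x * (x + y) - (x * y) ^+ j.+1 * x.
Proof.
move=> x0 x1 y0 y1 kt t0 oj agree lt.
have et := one_zeros_itinerary y x0.
have g := prefix_gap kt et agree.
rewrite -signr_odd (negbTE oj) mul1r (kt j) (et j) in g.
have xy0 : 0 < x * y by rewrite mulr_gt0.
have slope_ge d : (d <= 1)%N -> x * y <= slope x y d.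
  by move=> /(slope_anti (ltW x0) (ltW y0) y1); rewrite {1}/slope expr1.
have wj : (x * y) ^+ j <= weight x y k j.
  rewrite -[j in _ ^+ j]card_ord -prodr_const; apply: ler_prod => i _.
  by rewrite (ltW xy0) /= slope_ge // agree //; case: (i : nat).
have step : slope x y (one_zeros j) * x <=
    (1 + x) * (branch x y (one_zeros j) (one_zeros_tail x y j.+1) - branch x y (k j) (t j.+1)).
  rewrite /branch; have := peak_anti (ltW x0) (ltW y0) lt; rewrite peakS.
  have := mulr_ge0 (slope_ge0 (k j) (ltW x0) (ltW y0)) (t0 j.+1).
  have : slope x y (one_zeros j) * one_zeros_tail x y j.+1 * (1 + x) = slope x y (one_zeros j).
    by rewrite /= -mulrA mulVf ?mulr1 //; lra.
  move: (slope x y (one_zeros j)) (slope x y (k j) * _) (one_zeros_tail x y j.+1) (peak _ _ _) (peak _ _ _).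
  by move=> *; nra.
have h1 : x * y * x <= slope x y (one_zeros j) * x.
  by rewrite ler_pM2r // slope_ge //; case: (j).
have h2 : (x * y) ^+ j * (x * y * x) <=
    weight x y k j * ((1 + x) * (branch x y (one_zeros j) (one_zeros_tail x y j.+1) - branch x y (k j) (t j.+1))).
  apply: ler_pM => //; [exact: exprn_ge0 (ltW xy0)|by rewrite !mulr_ge0 // ltW|lra].
have e0 : one_zeros_tail x y 0 * (1 + x) = 1 - x * (x + y) by rewrite /= divfK //; lra.
have g' : (one_zeros_tail x y 0 - t 0%N) * (1 + x) = weight x y k j * ((1 + x) *
    (branch x y (one_zeros j) (one_zeros_tail x y j.+1) - branch x y (k j) (t j.+1))).
  by rewrite g; ring.
by rewrite exprSr -e0; lra.
Qed.

End Zero.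

(** * Levels and cells *)

(** The lengths of u_(m-1) and v_(m-1); level 0 is the original family. *)
Definition expo (m : nat) : nat * nat :=
  iter m (fun ab => (ab.1 + ab.2, ab.1.*2)%N) (1, 0)%N.

Section Levels.
Variable R : realType.
Implicit Types (z w : R) (m : nat) (k : nat -> nat).

Definition upow m z : R := z ^+ (expo m).1.

Definition vpow m z : R := z ^+ (expo m).2.

Lemma upowS m z : upow m.+1 z = upow m z * vpow m z.
Proof. by rewrite /upow /vpow /= exprD. Qed.

Lemma vpowS m z : vpow m.+1 z = upow m z ^+ 2.
Proof. by rewrite /upow /vpow /= -muln2 exprM. Qed.

Lemma uvpowS m z : upow m.+1 z + vpow m.+1 z = upow m z * (upow m z + vpow m z).
Proof. by rewrite upowS vpowS; ring. Qed.

Lemma expo_gt0 m : (0 < (expo m).1)%N.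
Proof. by elim: m => //= m IHm; rewrite addn_gt0 IHm. Qed.

Lemma upow_bounds m z : 0 < z -> z < 1 -> 0 < upow m z < 1.
Proof. by move=> z0 z1; rewrite exprn_gt0 //= exprn_ilt1 ?ltW // -lt0n expo_gt0. Qed.

Lemma vpow_bounds m z : 0 < z -> z < 1 -> 0 < vpow m z <= 1.
Proof. by move=> z0 z1; rewrite exprn_gt0 //= exprn_ile1 ?ltW. Qed.

Lemma upow_mono m z w : 0 <= z -> z < w -> upow m z < upow m w.
Proof.
by move=> z0 zw; rewrite /upow ltrXn2r // -lt0n expo_gt0.
Qed.

Lemma vpow_mono m z w : 0 <= z -> z < w -> vpow m z <= vpow m w.
Proof. by move=> z0 zw; apply: lerXn2r; rewrite ?nnegrE; lra. Qed.

Lemma uvpow_mono m z w : 0 <= z -> z < w -> upow m z + vpow m z < upow m w + vpow m w.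
Proof. by move=> z0 zw; have := upow_mono m z0 zw; have := vpow_mono m z0 zw; lra. Qed.

Lemma upow_continuous m : continuous (upow m).
Proof. exact: exprn_continuous. Qed.

Lemma vpow_continuous m : continuous (vpow m).
Proof. exact: exprn_continuous. Qed.

Lemma expr_lipschitz z w n : 0 <= z <= 1 -> 0 <= w <= 1 ->
  `|z ^+ n - w ^+ n| <= n%:R * `|z - w|.
Proof.
move=> z01 w01; elim: n => [|n IHn]; first by rewrite !expr0 subrr normr0 mul0r.
have -> : z ^+ n.+1 - w ^+ n.+1 = z * (z ^+ n - w ^+ n) + (z - w) * w ^+ n.
  by rewrite !exprS; ring.
apply: le_trans (ler_normD _ _) _; rewrite -natr1 [leRHS]mulrDl mul1r !normrM.
rewrite (ger0_norm (_ : 0 <= z)) ?(ger0_norm (_ : 0 <= w ^+ n)) ?exprn_ge0; try lra.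
apply: lerD; last by rewrite ler_piMr // exprn_ile1; lra.
by apply: le_trans IHn; rewrite ler_piMl //; lra.
Qed.

Lemma slope_level m z d : slope (upow m z) (vpow m z) d = z ^+ ((expo m).1 + (expo m).2 * d).
Proof. by rewrite /slope /upow /vpow -exprM exprD. Qed.

Lemma slope_lipschitz m z w (K : nat) d : 0 <= z <= 1 -> 0 <= w <= 1 -> (d <= K)%N ->
  `|slope (upow m z) (vpow m z) d - slope (upow m w) (vpow m w) d| <=
  ((expo m).1 + (expo m).2 * K)%:R * `|z - w|.
Proof.
move=> z01 w01 dK; rewrite !slope_level.
apply: le_trans (expr_lipschitz _ z01 w01) _; apply: ler_wpM2r => //.
by rewrite ler_nat leq_add2l leq_mul2l dK orbT.
Qed.

Lemma peak_lipschitz m z w (K : nat) d : 0 <= z <= 1 -> 0 <= w <= 1 -> (d <= K)%N ->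
  `|peak (upow m z) (vpow m z) d - peak (upow m w) (vpow m w) d| <=
  K%:R * (((expo m).1 + (expo m).2 * K)%:R * `|z - w|).
Proof.
move=> z01 w01 dK; apply: (@le_trans _ _ (d%:R * (((expo m).1 + (expo m).2 * K)%:R * `|z - w|))).
  elim: d dK => [|d IHd] dK; first by rewrite !peak0 subrr normr0 mul0r.
  rewrite !peakS -natr1 [leRHS]mulrDl mul1r.
  have eqD (a b c e : R) : a - b - (c - e) = (a - c) - (b - e) by ring.
  rewrite eqD; apply: le_trans (ler_normB _ _) _.
  apply: lerD; first by apply: IHd; exact: ltnW.
  by apply: slope_lipschitz => //; exact: ltnW.
by apply: ler_wpM2r; rewrite ?ler_nat // mulr_ge0.
Qed.

(** The two solutions of the recursion differ at each step by a multiple of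
    |z - w|, and the differences are summed by the contraction. *)
Lemma value_lipschitz m k (K : nat) (h : R) : 0 <= h -> h < 1 ->
  (forall i, (k i <= K)%N) -> exists C, forall z w, 0 <= z <= h -> 0 <= w <= h ->
  `|value (upow m z) (vpow m z) k - value (upow m w) (vpow m w) k| <= C * `|z - w|.
Proof.
move=> h0 h1 kK.
pose E : R := ((expo m).1 + (expo m).2 * K)%:R.
have Xh z : 0 <= z <= h -> 0 <= upow m z <= upow m h.
  by move=> zh; rewrite exprn_ge0 /=; [apply: lerXn2r; rewrite ?nnegrE; lra|lra].
have Xh1 : upow m h < 1 by rewrite exprn_ilt1 // -lt0n expo_gt0.
pose B : R := value_bound (upow m h) K.
pose F : R := K%:R * E + E * B.
exists (F / (1 - upow m h)) => z w zh wh.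
have [z01 w01] : 0 <= z <= 1 /\ 0 <= w <= 1 by split; lra.
have Y01 v : 0 <= v <= h -> 0 <= vpow m v <= 1.
  by move=> vh; rewrite exprn_ge0 ?exprn_ile1; lra.
have itin v : 0 <= v <= h ->
    itinerary (upow m v) (vpow m v) k (fun i => value (upow m v) (vpow m v) (shiftn k i)).
  move=> vh; have := Xh v vh; have := Y01 v vh => /andP[? ?] /andP[? ?].
  by apply: value_itinerary kK => //; lra.
have bnd v : 0 <= v <= h -> forall i, `|value (upow m v) (vpow m v) (shiftn k i)| <= B.
  move=> vh i; have := Xh v vh; have := Y01 v vh => /andP[? ?] /andP[? ?].
  apply: (@le_trans _ _ (value_bound (upow m v) K)).
    by apply: value_norm => //; [lra|move=> j; exact: kK].
  by rewrite ler_pM2l ?ltr0Sn // lef_pV2 ?posrE; lra.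
have kz := itin z zh; have kw := itin w wh.
pose delta i := `|value (upow m z) (vpow m z) (shiftn k i) - value (upow m w) (vpow m w) (shiftn k i)|.
have E0 : 0 <= E by rewrite ler0n.
have delta_step i : delta i <= F * `|z - w| + upow m h * delta i.+1.
  rewrite /delta (kz i) (kw i) /branch.
  set s := slope (upow m z) _ _; set s' := slope (upow m w) _ _.
  set a := value _ _ (shiftn k i.+1); set b := value _ _ (shiftn k i.+1).
  set c := peak _ _ _; set c' := peak _ _ _.
  have -> : c - s * a - (c' - s' * b) = (c - c') + - ((s - s') * b) + - (s * (a - b)) by ring.
  apply: le_trans (ler_normD _ _) _; rewrite normrN normrM lerD //.
    apply: le_trans (ler_normD _ _) _; rewrite normrN normrM mulrDl lerD //.
      by rewrite -mulrA; exact: peak_lipschitz.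
    rewrite mulrAC; apply: ler_pM; rewrite ?bnd //; exact: slope_lipschitz.
  have /andP[? ?] := Xh z zh; have /andP[? ?] := Y01 z zh.
  rewrite ger0_norm ?slope_ge0 // ler_wpM2r //.
  by apply: (le_trans (slope_le _ _ _ _)).
have B0 : 0 <= B by apply: le_trans (bnd z zh 0%N).
pose M := F * `|z - w| / (1 - upow m h).
have ME : M = F * `|z - w| + upow m h * M by rewrite /M; field; lra.
have F0 : 0 <= F by rewrite addr_ge0 // mulr_ge0.
have M0 : 0 <= M by rewrite mulr_ge0 ?invr_ge0 ?(mulr_ge0 F0) //; lra.
have : forall i, 0 <= M - delta i.
  apply: (contraction_ge0 Xh1) => [|L L0 dL i].
    exists (M - (B + B)) => i; rewrite lerD2l lerN2.
    by apply: le_trans (ler_normB _ _) _; rewrite lerD // bnd.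
  have := delta_step i; have := dL i.+1; have /andP[X0 _] := Xh h (introT andP (conj h0 (lexx h))).
  move: (delta i) (delta i.+1) => u v uL vU.
  have : upow m h * (L + v - M) <= 0 by rewrite mulr_ge0_le0 //; lra.
  by move: ME; lra.
move=> /(_ 0%N); rewrite subr_ge0 /delta shiftn0 /M; move/le_trans; apply.
by rewrite mulrAC.
Qed.

End Levels.

(** * All cells produce the same sequences *)

Section Roots.
Variable R : realType.
Implicit Types (x y z w : R) (m : nat) (t : nat -> R) (k : nat -> nat).

Lemma uvpow_continuous m : continuous (fun z : R => upow m z + vpow m z).
Proof. by move=> z; apply: cvgD; [exact: upow_continuous|exact: vpow_continuous]. Qed.

Lemma cell_right_end m : exists2 z : R, 0 < z < 1 & upow m.+1 z + vpow m.+1 z = 1.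
Proof.
have b0 : (0 < (expo m.+1).2)%N by rewrite /= double_gt0 expo_gt0.
have v0 : upow m.+1 (0 : R) + vpow m.+1 0 = 0.
  by rewrite /upow /vpow !expr0n !gtn_eqF ?expo_gt0 //= addr0.
have v1 : upow m.+1 (1 : R) + vpow m.+1 1 = 2 by rewrite /upow /vpow !expr1n.
have [|z /[!in_itv]/= /andP[z0 z1] e] := @IVT R (fun z => upow m.+1 z + vpow m.+1 z) 0 1 1 ler01
  (continuous_subspaceT (@uvpow_continuous m.+1)).
  by rewrite v0 v1 ge_min le_max ler01 ler1n orbT.
exists z => //; rewrite !lt_neqAle z0 z1 !andbT; apply/andP; split; apply/eqP => ez.
  by move: e; rewrite -ez v0; lra.
by move: e; rewrite ez v1; lra.
Qed.

Lemma cell_left_end m : exists2 z : R, 0 <= z < 1 & upow m z + vpow m z = 1.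
Proof.
case: m => [|m]; last by have [z z01 e] := cell_right_end m; exists z => //; lra.
by exists 0; [lra|rewrite /upow /vpow /= expr0 expr1 add0r].
Qed.

(** The value of k is positive at the left end of the cell and negative slightly
    before the right end.  At the right end itself it may vanish without coding
    a point of [0, 1]; for instance 2(10)^oo does so at level 0. *)
Lemma level_root m k : selfmin k -> altlt k one_zeros -> exists z : R,
  [/\ 0 < z, z < 1, 1 < upow m z + vpow m z, upow m.+1 z + vpow m.+1 z < 1 &
      value (upow m z) (vpow m z) k = 0].
Proof.
move=> km [j agree].
have kK i := selfmin_digit i km.
case: ifP => oj lt; first by case: j oj lt agree => // j; rewrite ltn0.
have [lo /andP[lo0 lo1] loE] := cell_left_end m.
have [hi /andP[hi0 hi1] hiE] := cell_right_end m.
have lohi : lo < hi.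
  rewrite ltNge; apply/negP; rewrite le_eqVlt => /predU1P[e|lt'].
    move: hiE; rewrite uvpowS e loE mulr1 => x1.
    by have := upow_bounds m hi0 hi1; rewrite e x1; lra.
  have := uvpow_mono m.+1 (ltW hi0) lt'; rewrite hiE uvpowS loE mulr1.
  have lo0' : 0 < lo by lra.
  by have := upow_bounds m lo0' lo1; lra.
(* The bound of [value_lt_one_zeros] is - f. *)
pose f z := (upow m z * vpow m z) ^+ j.+1 * upow m z - (1 - (upow m.+1 z + vpow m.+1 z)).
have [w lo_w [w_hi fw]] : exists2 w, lo < w & w < hi /\ 0 < f w.
  have fhi : 0 < f hi.
    have := upow_bounds m hi0 hi1; have := vpow_bounds m hi0 hi1.
    by rewrite /f hiE subrr subr0 => /andP[? _] /andP[? _]; rewrite mulr_gt0 // exprn_gt0 // mulr_gt0.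
  have fc : f z @[z --> hi] --> f hi.
    apply: cvgB; last by apply: cvgB; [exact: cvg_cst|exact: uvpow_continuous].
    apply: cvgM; last exact: upow_continuous.
    apply: (@continuous_comp _ _ _ (fun z => upow m z * vpow m z) (fun z => z ^+ j.+1)).
      by apply: cvgM; [exact: upow_continuous|exact: vpow_continuous].
    exact: exprn_continuous.
  have fl : \forall z \near hi^'-, 0 < f z.
    exact: (cvgr_gt _ (cvg_at_left_filter fc)).
  have [w [[? ?] ?]] := filter_ex (filterI (filterI (nbhs_left_lt hi) (nbhs_left_gt lohi)) fl).
  by exists w.
have w0 : 0 < w by lra. have w1 : w < 1 by lra.
have /andP[X0 X1] := upow_bounds m w0 w1; have /andP[Y0 Y1] := vpow_bounds m w0 w1.
have XYw : upow m w * (upow m w + vpow m w) < 1 by rewrite -uvpowS -hiE; exact: uvpow_mono (ltW w0) w_hi.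
have vw : value (upow m w) (vpow m w) k < 0.
  rewrite ltNge; apply/negP => v0.
  have vb := selfmin_value_bounds X0 X1 Y0 Y1 XYw km v0.
  have := value_lt_one_zeros X0 X1 Y0 Y1 (value_itinerary (ltW X0) X1 (ltW Y0) Y1 kK)
    (fun i => (elimT andP (vb i)).1) (negbT oj) agree lt.
  by rewrite shiftn0 -uvpowS; move: fw; rewrite /f; nra.
have vlo : 0 < value (upow m lo) (vpow m lo) k.
  have Xlo1 : upow m lo < 1 by rewrite exprn_ilt1 // -lt0n expo_gt0.
  have Xlo0 : 0 <= upow m lo by rewrite exprn_ge0.
  by apply: (value_gt0_degenerate _ _ _ _ loE kK) => //; lra.
pose g z := value (upow m z) (vpow m z) k.
have [C gC] := value_lipschitz m (ltW hi0) hi1 kK.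
have gcont : {within `[lo, w], continuous g}.
  apply/subspace_continuousP => z /=; rewrite in_itv /= => /andP[zl zw].
  apply/cvgrPdist_le => e e0; rewrite near_withinE; near=> u; rewrite /= in_itv /= => /andP[ul uw].
  apply: (le_trans (gC z u _ _)); [lra|lra|].
  apply: (@le_trans _ _ ((`|C| + 1) * `|z - u|)).
    by apply: ler_wpM2r => //; have := ler_norm C; lra.
  rewrite -ler_pdivlMl; last by have := normr_ge0 C; lra.
  rewrite mulrC; near: u; apply: cvgr_dist_le; first exact: cvg_id.
  by rewrite divr_gt0 //; have := normr_ge0 C; lra.
have [|z /[!in_itv]/= /andP[zl zw] gz] := @IVT R g lo w 0 (ltW lo_w) gcont.
  by rewrite ge_min le_max /g (ltW vw) (ltW vlo) orbT.
have zlo : lo < z.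
  by rewrite lt_neqAle zl andbT; apply/eqP => e; move: vlo; rewrite e -/(g z) gz ltxx.
exists z; split => //; try lra.
- by rewrite -loE; exact: uvpow_mono.
- by rewrite -hiE; apply: uvpow_mono; lra.
Unshelve. all: by end_near.
Qed.

(** As the last sum is x (x + y) for x = upow m z and y = vpow m z, the cells of
    consecutive levels abut. *)
Definition cell m z : Prop :=
  [/\ 0 < z, 1 < upow m z + vpow m z & upow m.+1 z + vpow m.+1 z <= 1].

Lemma uvpow_gt1 m z : 1 <= z -> 1 < upow m z + vpow m z.
Proof. by move=> z1; have := exprn_ege1 (expo m).1 z1; have := exprn_ege1 (expo m).2 z1; rewrite /upow /vpow; lra. Qed.

Lemma cell_lt1 m z : cell m z -> z < 1.
Proof. by case=> _ _ le; rewrite ltNge; apply/negP => /(uvpow_gt1 m.+1); lra. Qed.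

(** Whether a tail of k is 0 does not depend on the parameters.  Let M be the
    supremum of the tails t_i over the indices i with t'_i = 0.  For such an i, k
    and its shift have the same value 0 for (x', y'), so that they first differ by
    the two codings of one end point, which are followed by tails that vanish for
    (x', y') too.  For (x, y) this bounds t_i by x (x + y) M, whence M = 0. *)
Lemma zero_transfer x y x' y' k t t' : 0 < x -> x < 1 -> 0 < y -> y <= 1 ->
  x * (x + y) < 1 -> 0 < x' -> x' < 1 -> 0 < y' -> y' <= 1 ->
  kneads x y k t -> itinerary x' y' k t' -> t' 0%N = 0 ->
  (forall i, 0 <= t' i <= 1) -> forall i, t' i = 0 -> t i = 0.
Proof.
move=> x0 x1 y0 y1 xy x'0 x'1 y'0 y'1 K kt' t'0 t'b i ti.
have [t0 kt _] := K; have tb := kneads_bounds K.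
have km := kneads_selfmin x0 x1 y0 y1 K.
pose f j := if t' j == 0 then - t j else 0.
suff : 0 <= f i by rewrite /f ti eqxx; have := tb i; lra.
apply: (contraction_ge0 xy) => [|L L0 fL {ti}i].
  by exists (-1) => j; rewrite /f; have := tb j; case: eqP; lra.
have c0 : x * (x + y) * L <= 0.
  by rewrite mulr_ge0_le0 // mulr_ge0 ?addr_ge0 // ltW.
rewrite /f; case: eqP => // ti; rewrite lerNr.
have tL j : t' j = 0 -> t j <= - L by move=> e; have := fL j; rewrite /f e eqxx; lra.
have kti := itinerary_shift i kt; have kti' := itinerary_shift i kt'.
have bound q d s s' : 0 < q <= 1 -> s <= - L -> s' <= - L ->
    q * (branch x y d (branch x y 0 s) - branch x y d.+1 s') <= - (x * (x + y) * L).
  move=> /andP[q0 q1] sL s'L.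
  have -> : branch x y d (branch x y 0 s) - branch x y d.+1 s' =
      slope x y d * (x * s + y * s').
    by rewrite /branch peak0 peakS slopeS /slope; ring.
  have h : x * s + y * s' <= (x + y) * - L.
    by rewrite mulrDl lerD // ler_pM2l.
  have h' : slope x y d * (x * s + y * s') <= slope x y d * ((x + y) * - L).
    by rewrite ler_pM2l // slope_gt0.
  have h'' : slope x y d * ((x + y) * - L) <= x * ((x + y) * - L).
    apply: ler_wpM2r; last exact: slope_le (ltW x0) (ltW y0) y1.
    by rewrite mulr_ge0 //; lra.
  have : q * (slope x y d * (x * s + y * s')) <= q * (x * ((x + y) * - L)).
    by rewrite ler_pM2l //; lra.
  by have : q * (x * ((x + y) * - L)) <= x * ((x + y) * - L); [rewrite ler_piMl //|]; lra.
have [e|[/km//|]] := altlt_total (shiftn k i) k.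
  have ek : shiftn k i = k by exact/funext.
  have bd : exists B, forall j, `|t j - t (i + j)%N| <= B.
    by exists 1 => j; have := tb j; have := tb (i + j)%N; rewrite ler_norml; lra.
  rewrite ek in kti.
  have := itinerary_uniq (ltW x0) x1 (ltW y0) y1 kt kti bd 0%N.
  by rewrite /= addn0 t0 => <-; lra.
move=> /(@altlt_gap R)[j]; rewrite /shiftn /=.
case=> -[oj kj gap].
all: have [q' /andP[q'0 _] e'] := gap x' y' _ _ x'0 x'1 y'0 y'1 kt' kti'.
all: have [q q01 e] := gap x y _ _ x0 x1 y0 y1 kt kti.
all: move: e' e; rewrite /= !addn0 t'0 ti t0 !subr0 -?addnS.
all: move=> /esym/eqP; rewrite mulf_eq0 gt_eqF //= subr_eq0 => /eqP e' ->.
- have /andP[_ b1] := t'b j.+1; have /andP[b2 _] := t'b (i + j.+1)%N.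
  have [|d1 t1 t2] := branch_meet x'0 y'0 kj b1 b2; first by rewrite e'.
  have /andP[b3 _] := t'b j.+2.
  have [k0 t3] := branch_eq1 x'0 x'1 y'0 b3 (etrans (esym (kt' j.+1)) t1).
  by rewrite d1 (kt j.+1) k0; apply: bound; rewrite // tL.
- have /andP[_ b1] := t'b (i + j.+1)%N; have /andP[b2 _] := t'b j.+1.
  have [|d1 t1 t2] := branch_meet x'0 y'0 kj b1 b2; first by rewrite e'.
  have /andP[b3 _] := t'b (i + j.+1).+1.
  have [k0 t3] := branch_eq1 x'0 x'1 y'0 b3 (etrans (esym (kt' _)) t1).
  by rewrite d1 (kt (i + j.+1)%N) k0; apply: bound; rewrite // tL.
Qed.

Lemma cell_bounds m z : cell m z ->
  [/\ 0 < upow m z, upow m z < 1, 0 < vpow m z, vpow m z <= 1 & upow m z * (upow m z + vpow m z) <= 1].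
Proof.
move=> c; have z1 := cell_lt1 c; have [z0 _ le] := c.
by have := upow_bounds m z0 z1; have := vpow_bounds m z0 z1; rewrite -uvpowS => /andP[? ?] /andP[].
Qed.

(** The sequence k is realised at level m' by a zero of its value there; the
    parity condition is inherited through [zero_transfer]. *)
Lemma cell_transfer m m' z k t : cell m z -> kneads (upow m z) (vpow m z) k t ->
  exists z' t', cell m' z' /\ kneads (upow m' z') (vpow m' z') k t'.
Proof.
move=> c K; have [x0 x1 y0 y1 xy] := cell_bounds c.
have [e|[lt|/(kneads_le_one_zeros x0 x1 y0 y1 xy K)//]] := altlt_total k one_zeros.
  have [z' /andP[z'0 z'1] e'] := cell_right_end m'.
  have /andP[X0 X1] := upow_bounds m' z'0 z'1.
  exists z', (one_zeros_tail (upow m' z') (vpow m' z')); split.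
    by split => //; [move: e'; rewrite uvpowS; nra|rewrite e'].
  by rewrite (_ : k = one_zeros); [apply: one_zeros_kneads; rewrite -?uvpowS|exact/funext].
have km := kneads_selfmin x0 x1 y0 y1 K.
have [z' [z'0 z'1 lo hi v0]] := level_root m' km lt.
have /andP[x'0 x'1] := upow_bounds m' z'0 z'1; have /andP[y'0 y'1] := vpow_bounds m' z'0 z'1.
exists z', (fun i => value (upow m' z') (vpow m' z') (shiftn k i)).
have xy' : upow m' z' * (upow m' z' + vpow m' z') < 1 by rewrite -uvpowS.
have v_ge : 0 <= value (upow m' z') (vpow m' z') k by rewrite v0.
have vb := selfmin_value_bounds x'0 x'1 y'0 y'1 xy' km v_ge.
have kt' : itinerary (upow m' z') (vpow m' z') k (fun i => value (upow m' z') (vpow m' z') (shiftn k i)).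
  by apply: (value_itinerary (ltW x'0) x'1 (ltW y'0) y'1) => i; exact: selfmin_digit.
have xy1 : upow m z * (upow m z + vpow m z) < 1.
  rewrite lt_neqAle xy andbT; apply/eqP => e.
  have [ke _] := kneads_uniq x0 y0 K (one_zeros_kneads x0 e).
  have [j _] := lt; case: ifP => _; by rewrite ke ltnn.
have tz i : value (upow m' z') (vpow m' z') (shiftn k i) = 0 -> t i = 0.
  by apply: (zero_transfer x0 x1 y0 y1 xy1 x'0 x'1 y'0 y'1 K kt'); rewrite ?shiftn0.
have neq0 i : odd i -> value (upow m' z') (vpow m' z') (shiftn k i) != 0.
  by move=> /(kneads_odd K) ti; apply/eqP => /tz e; rewrite e ltxx in ti.
split; first by split => //; exact: ltW.
split => //.
move=> i; have /andP[v_ge0 v_le1] := vb i; case: ifP => oi.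
  by rewrite v_le1 lt_neqAle eq_sym neq0 // v_ge0.
rewrite v_ge0 lt_neqAle v_le1 andbT; apply/eqP => v1.
have /andP[vS _] := vb i.+1.
have [_ vS0] := branch_eq1 x'0 x'1 y'0 vS (etrans (esym (kt' i)) v1).
by have := @neq0 i.+1; rewrite /= oi vS0 eqxx => /(_ isT).
Qed.
End Roots.

(** * Existence of kneading sequences *)

Section Greedy.
Variable R : realType.
Implicit Types (x y s : R).

Lemma digit_exists x y : 0 < x -> 0 < y -> y < 1 -> 1 < x + y ->
  exists d, peak x y d < 0.
Proof.
move=> x0 y0 y1 xy.
have peakE d : (1 - y) * peak x y d = 1 - y - x * (1 - y ^+ d).
  elim: d => [|d IHd]; first by rewrite peak0 expr0; ring.
  by rewrite peakS mulrBr IHd /slope exprS; ring.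
have c : y ^+ n @[n --> \oo] --> (0 : R) by apply: cvg_expr; rewrite gtr0_norm.
have e0 : 0 < (x + y - 1) / x by rewrite divr_gt0 //; lra.
have [d _ /(_ d (leqnn d))] := cvgr_lt _ c _ e0.
rewrite /= ltr_pdivlMr // => yd; exists d.
have : (1 - y) * peak x y d < 0 by rewrite peakE; lra.
by rewrite pmulr_rlt0 //; lra.
Qed.

Lemma greedy_step x y (i : nat) s : 0 < x -> 0 < y -> y < 1 -> 1 < x + y ->
  (if odd i then 0 < s <= 1 else 0 <= s < 1) ->
  exists p : nat * R, s = branch x y p.1 p.2 /\
    (if odd i.+1 then 0 < p.2 <= 1 else 0 <= p.2 < 1).
Proof.
move=> x0 y0 y1 xy; have [D peakD] := digit_exists x0 y0 y1 xy.
have D0 : (0 < D)%N by case: D peakD => //; rewrite peak0; lra.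
pose inv d := (peak x y d - s) / slope x y d.
have invE d : s = branch x y d (inv d).
  by rewrite /branch /inv mulrC divfK ?lt0r_neq0 ?slope_gt0 //; ring.
case: ifP => oi s01 /=; rewrite oi /=.
- have ex : exists d, peak x y d.+1 < s.
    by exists D.-1; rewrite prednK //; lra.
  exists (ex_minn ex, inv (ex_minn ex)) => /=; split => //.
  case: ex_minnP => d lt dmin; have q0 := slope_gt0 d x0 y0.
  have ge : s <= peak x y d.
    case: d dmin {lt q0} => [|d] dmin; first by rewrite peak0; lra.
    by rewrite leNgt; apply/negP => /dmin; rewrite ltnn.
  rewrite divr_ge0 ?subr_ge0 ?(ltW q0) //= ltr_pdivrMr // mul1r.
  by move: lt; rewrite peakS; lra.
- have ex : exists d, peak x y d.+1 <= s.
    by exists D.-1; rewrite prednK //; lra.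
  exists (ex_minn ex, inv (ex_minn ex)) => /=; split => //.
  case: ex_minnP => d le dmin; have q0 := slope_gt0 d x0 y0.
  have gt : s < peak x y d.
    case: d dmin {le q0} => [|d] dmin; first by rewrite peak0; lra.
    by rewrite ltNge; apply/negP => /dmin; rewrite ltnn.
  rewrite divr_gt0 ?subr_gt0 //= ler_pdivrMr // mul1r.
  by move: le; rewrite peakS; lra.
Qed.

Lemma kneads_exists x y : 0 < x -> 0 < y -> y < 1 -> 1 < x + y ->
  exists k t, kneads x y k t.
Proof.
move=> x0 y0 y1 xy.
have step (q : nat * R) : exists p : nat * R,
    (if odd q.1 then 0 < q.2 <= 1 else 0 <= q.2 < 1) ->
    q.2 = branch x y p.1 p.2 /\
    (if odd q.1.+1 then 0 < p.2 <= 1 else 0 <= p.2 < 1).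
  have [h|h] := pselect (if odd q.1 then 0 < q.2 <= 1 else 0 <= q.2 < 1).
    by have [p hp] := greedy_step x0 y0 y1 xy h; exists p.
  by exists (0%N, 0).
have [g gP] := choice step.
pose t := fix t i : R := if i is j.+1 then (g (j, t j)).2 else 0.
have tP i : if odd i then 0 < t i <= 1 else 0 <= t i < 1.
  elim: i => [|i IHi]; first by rewrite /= lexx ltr01.
  by have [_] := gP (i, t i) IHi.
exists (fun i => (g (i, t i)).1), t; split => // i.
by have [] := gP (i, t i) (tP i).
Qed.
End Greedy.

(** * Renormalisation by phi *)

Lemma phi_word_cat (v w : seq nat) : phi_word (v ++ w) = phi_word v ++ phi_word w.
Proof. by rewrite /phi_word map_cat flatten_cat. Qed.

Lemma size_phi_word (w : seq nat) : (size w <= size (phi_word w))%N.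
Proof.
by elim: w => //= d w IHw; rewrite ltnS size_cat (leq_trans IHw) // leq_addl.
Qed.

Lemma phi_seq_nth (k : nat -> nat) (i n : nat) : (i < n)%N ->
  nth 0%N (phi_word (mkseq k n)) i = phi_seq k i.
Proof.
move=> /subnKC <-; rewrite /mkseq iotaD map_cat phi_word_cat nth_cat ifT //.
by apply: leq_trans (size_phi_word _); rewrite size_map size_iota.
Qed.

Lemma mkseqSl (k : nat -> nat) (n : nat) :
  mkseq k n.+1 = k 0%N :: mkseq (shiftn k 1) n.
Proof.
by rewrite /mkseq /= -[1%N]addn0 iotaDl -map_comp.
Qed.

Lemma phi_seq_head (k : nat -> nat) (r : nat) : (r <= (k 0%N).*2)%N ->
  phi_seq k r = (r == 0%N).
Proof.
move=> rk; rewrite /phi_seq mkseqSl /= ; case: r rk => //= r rk.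
by rewrite nth_cat size_nseq rk nth_nseq rk.
Qed.

Lemma phi_seq_tail (k : nat -> nat) (i : nat) :
  phi_seq k ((k 0%N).*2.+1 + i) = phi_seq (shiftn k 1) i.
Proof.
rewrite {1}/phi_seq mkseqSl -[RHS](@phi_seq_nth _ _ ((k 0%N).*2.+1 + i)); last lia.
by rewrite addSn /= nth_cat size_nseq ifN -?leqNgt ?leq_addr // addKn.
Qed.

Lemma phi_seq_inj (k l : nat -> nat) : phi_seq k =1 phi_seq l -> k =1 l.
Proof.
have le0 (k' l' : nat -> nat) : phi_seq k' =1 phi_seq l' -> (l' 0 <= k' 0)%N.
  move=> e; rewrite leqNgt; apply/negP => lt.
  have := e ((k' 0%N).*2.+1 + 0)%N; rewrite phi_seq_tail phi_seq_head //.
  by rewrite phi_seq_head // addn0 ltn_double.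
move=> e j; elim: j k l e => [|j IHj] k l e.
  by apply/eqP; rewrite eqn_leq !le0 // => i; rewrite e.
apply: (IHj (shiftn k 1) (shiftn l 1)) => i.
have k0 : k 0%N = l 0%N by apply/eqP; rewrite eqn_leq !le0 // => ?; rewrite e.
by rewrite -!phi_seq_tail e k0.
Qed.

Lemma iter_phi_seq_inj (n : nat) (k l : nat -> nat) :
  iter n phi_seq k =1 iter n phi_seq l -> k =1 l.
Proof. by elim: n => //= n IHn /phi_seq_inj. Qed.

(** The index j of the block 1(00)^(k_j) of phi(k) that contains the position i,
    and the offset of i in this block. *)
Fixpoint block_pos (k : nat -> nat) (i : nat) : nat * nat :=
  if i is i'.+1 then
    let: (j, r) := block_pos k i' in
    if r == (k j).*2 then (j.+1, 0%N) else (j, r.+1)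
  else (0%N, 0%N).

Lemma block_posP (k : nat -> nat) (i j r : nat) : block_pos k i = (j, r) ->
  (r <= (k j).*2)%N /\ exists s, [/\ i = (s + r)%N, odd s = odd j &
      forall n, phi_seq k (s + n) = phi_seq (shiftn k j) n].
Proof.
elim: i j r => [|i IHi] j r /=.
  by case=> <- <-; split=> //; exists 0%N; split => // n; rewrite shiftn0.
case: (block_pos k i) IHi => j' r' /(_ _ _ erefl)[r'k [s [-> par tl]]].
case: eqP => er [<- <-]; split => //.
- exists (s + (k j').*2.+1)%N; split => [||n].
  + by rewrite addn0 er addnS.
  + by rewrite /= oddD par /= odd_double addbT.
  + rewrite -addnA tl (_ : (k j').*2.+1 = (shiftn k j' 0).*2.+1); last by rewrite /shiftn addn0.
    rewrite phi_seq_tail; congr (phi_seq _ _); apply/funext => l.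
    by rewrite /shiftn addnA addn1.
- by rewrite ltn_neqAle r'k andbT; apply/eqP.
- by exists s; split => //; rewrite addnS.
Qed.

Lemma phi_seq_block (k : nat -> nat) (i j r : nat) : block_pos k i = (j, r) ->
  phi_seq k i = (r == 0%N) /\ odd i = odd j (+) odd r.
Proof.
move=> /block_posP[rk [s [-> par tl]]]; split; last by rewrite oddD par.
by rewrite tl phi_seq_head // /shiftn addn0.
Qed.

Section Renormalization.
Variable R : realType.
Implicit Types (x y w : R).

(** The value n zeros before the end of a block, if w is the tail of k that
    starts with the next digit.  At the start of a block the value is that tail
    multiplied by 1 - x. *)
Fixpoint zeros_tail x w (n : nat) : R :=
  if n is n'.+1 then 1 - x * zeros_tail x w n' else (1 - x) * w.

Definition phi_tail x (k : nat -> nat) (t : nat -> R) (i : nat) : R :=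
  let: (j, r) := block_pos k i in
  if r == 0%N then (1 - x) * t j else zeros_tail x (t j.+1) ((k j).*2.+1 - r).

Lemma zeros_tail_double x w n : zeros_tail x w n.*2 =
  (1 - x) * (\sum_(i < n) (x ^+ 2) ^+ i + (x ^+ 2) ^+ n * w).
Proof.
elim: n => [|n IHn]; first by rewrite big_ord0 expr0 add0r mul1r.
rewrite doubleS /= IHn big_ord_recl expr0 [(x ^+ 2) ^+ n.+1]exprS.
rewrite [in RHS](eq_bigr (fun i : 'I_n => x ^+ 2 * (x ^+ 2) ^+ i)) => [|i _]; last by rewrite lift0 exprS.
by rewrite -mulr_sumr; move: (\sum_(_ < _) _) (_ ^+ n) => s v; ring.
Qed.

Lemma zeros_tail_bounds x w (j n : nat) : 0 < x -> x < 1 ->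
  (if odd j then 0 < w <= 1 else 0 <= w < 1) ->
  if odd (j + n) then 0 < zeros_tail x w n <= 1 else 0 <= zeros_tail x w n < 1.
Proof.
move=> x0 x1 wj; elim: n => [|n IHn] /=.
  by rewrite addn0; move: wj; case: odd => /andP[? ?]; nra.
by rewrite addnS /=; move: IHn; case: odd => /= /andP[? ?]; nra.
Qed.

(** Two zeros act as w |-> 1 + x^2 w on the points (1 - x) w, so a whole block acts
    as the branch of index k_j for the parameters (x y, x^2).  Blocks have odd
    length, hence the parities of j and of the start of block j agree. *)
Lemma kneads_phi x y k t : 0 < x -> x < 1 ->
  kneads (x * y) (x ^+ 2) k t -> kneads x y (phi_seq k) (phi_tail x k t).
Proof.
move=> x0 x1 [t0 kt tP]; split.
- by rewrite /phi_tail /= t0 mulr0.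
- move=> i; rewrite /phi_tail /=; case e: (block_pos k i) => [j r].
  have [-> _] := phi_seq_block e; have [rk _] := block_posP e.
  have head : (1 - x) * t j = branch x y 1 (zeros_tail x (t j.+1) (k j).*2).
    rewrite zeros_tail_double kt /branch peakS peak0 /peak /slope -mulr_sumr expr0 expr1.
    by move: (\sum_(_ < _) _) => s; ring.
  case: (posnP r) => [r0|r0].
    subst r; rewrite /= head; congr branch.
    case: eqP => [/= e0|_]; first by rewrite -e0.
    by rewrite /= subSS subn0.
  case: (eqVneq r (k j).*2) => [->|ne].
    by rewrite subSnn /= /branch peak0 /slope expr0 mulr1.
  have lt : (r < (k j).*2)%N by rewrite ltn_neqAle ne.
  by rewrite subSn // /= subSS /branch peak0 /slope expr0 mulr1.
- move=> i; rewrite /phi_tail /=; case e: (block_pos k i) => [j r].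
  have [_ ->] := phi_seq_block e; have [rk _] := block_posP e.
  case: (posnP r) => [r0|r0].
    by subst r; rewrite /= addbF; have := tP j; case: odd => /andP[? ?]; nra.
  have := zeros_tail_bounds ((k j).*2.+1 - r) x0 x1 (tP j.+1).
  suff -> : odd (j.+1 + ((k j).*2.+1 - r)) = odd j (+) odd r by [].
  by rewrite oddD oddB ?leqW //= odd_double /=; case: odd; case: odd.
Qed.

Lemma kneads_iter_phi m (z : R) k t : 0 < z -> z < 1 ->
  kneads (upow m z) (vpow m z) k t -> exists t', kneads z 1 (iter m phi_seq k) t'.
Proof.
move=> z0 z1; elim: m k t => [|m IHm] k t K.
  by exists t; move: K; rewrite /upow /vpow /= expr1 expr0.
rewrite iterSr; have /andP[x0 x1] := upow_bounds m z0 z1.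
by rewrite upowS vpowS in K; have /IHm := kneads_phi x0 x1 K.
Qed.
End Renormalization.

(** * Characteristic sequences *)

Section Expansion.
Variable R : realType.
Implicit Types (b : R).

Definition offset b (i : nat) : R := iter i (Tb b) (lb b) - lb b.

Lemma offset_bounds b i : 0 <= offset b i < 1.
Proof.
case: i => [|i]; first by rewrite /offset /= subrr lexx ltr01.
rewrite /offset /= {1 3}/Tb; set v := b * _; have := floor_itv (v - lb b).
by rewrite intrD => /andP[? ?]; apply/andP; split; lra.
Qed.

Lemma expansion_itinerary b : b < -1 ->
  itinerary (- b^-1) 1 (expansion b) (offset b).
Proof.
move=> b1 i.
have peakE d : peak (- b^-1) 1 d = 1 - d%:R * - b^-1.
  elim: d => [|d IHd]; first by rewrite peak0 mul0r subr0.
  by rewrite peakS IHd /slope expr1n -natr1; ring.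
have b0 : b != 0 by lra.
have b1' : 1 - b != 0 by lra.
have vE : b * iter i (Tb b) (lb b) - lb b = - b * (1 - offset b i).
  by rewrite /offset; move: (iter _ _ _) => v; rewrite /lb; field.
have v0 : 0 <= b * iter i (Tb b) (lb b) - lb b.
  by rewrite vE; have := offset_bounds b i; nra.
have dE : (expansion b i)%:R = (Num.floor (b * iter i (Tb b) (lb b) - lb b))%:~R :> R.
  by rewrite /expansion natr_absz ger0_norm // floor_ge0.
have : offset b i.+1 = - b * (1 - offset b i) - (expansion b i)%:R.
  by rewrite -vE dE /offset /= {1}/Tb; ring.
by move=> ->; rewrite /branch peakE /slope expr1n; field.
Qed.

Lemma offset_period b q : (0 < q)%N -> offset b q = 0 ->
  is_period (expansion b) q /\ forall i, offset b (i + q) = offset b i.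
Proof.
move=> q0 /eqP; rewrite subr_eq0 => /eqP e.
split; first by split => // i; rewrite /expansion iterD e.
by move=> i; rewrite /offset iterD e.
Qed.

Lemma period_offset b q : b < -1 -> is_period (expansion b) q -> offset b q = 0.
Proof.
move=> b1 [q0 per]; have it := expansion_itinerary b1.
have z01 : 0 < - b^-1 < 1.
  by rewrite -invrN invr_gt0 invf_lt1; lra.
have itq : itinerary (- b^-1) 1 (expansion b) (fun j => offset b (q + j)%N).
  by move=> j; rewrite addnS -(per j) addnC; exact: it.
have u0 : offset b 0 = 0 by rewrite /offset /= subrr.
have /andP[z0 z1] := z01.
have := itinerary_uniq (ltW z0) z1 ler01 (lexx 1) it itq _ 0%N.
rewrite /= addn0 u0 => <- //.
by exists 1 => j; have := offset_bounds b j; have := offset_bounds b (q + j); rewrite ler_norml; lra.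
Qed.

(** If 0 returns to itself for the first time after an odd number p of steps, then
    the corrected sequence replaces the value 0 at index p by the value 1, spends
    one more digit 0 to come back to 0, and so has the even period p + 1.  If the
    orbit vanishes at an odd index, then its least period is odd, as it divides
    this index. *)
Lemma kneads_charseq b : b < -1 -> exists t, kneads (- b^-1) 1 (charseq b) t.
Proof.
move=> b1; have it := expansion_itinerary b1.
have z01 : 0 < - b^-1 < 1.
  by rewrite -invrN invr_gt0 invf_lt1; lra.
have u0 : offset b 0 = 0 by rewrite /offset /= subrr.
rewrite /charseq; case: pselect => [e|ne].
  case: (cid e) => p /= [op [[p0 per] pmin]].
  have up : offset b p = 0 by apply: period_offset.
  have un j : (0 < j < p)%N -> 0 < offset b j.
    move=> /andP[j0 jp]; have /andP[uj _] := offset_bounds b j.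
    rewrite lt_neqAle uj andbT eq_sym; apply/eqP => /(offset_period j0)[/pmin].
    by rewrite leqNgt jp.
  pose T i := let j := (i %% p.+1)%N in if j == p then 1 else offset b j.
  have modS i : (i.+1 %% p.+1 = if i %% p.+1 == p then 0 else (i %% p.+1).+1)%N.
    rewrite -addn1 -modnDml addn1; case: eqP => [->|/eqP ne]; first by rewrite modnn.
    by rewrite modn_small // ltnS ltn_neqAle ne -ltnS ltn_pmod.
  exists T; split.
  - by rewrite /T mod0n (ltn_eqF p0).
  - move=> i; rewrite /T /odd_correction modS.
    have : (i %% p.+1 < p.+1)%N by rewrite ltn_pmod.
    move: (i %% p.+1)%N => j jp; case: (eqVneq j p) => [ej|njp].
      by rewrite /= (ltn_eqF p0) u0 /branch peak0 mulr0 subr0.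
    case: (eqVneq j p.-1) => [jp1|njp1]; last first.
      rewrite ifN; first exact: it.
      by apply: contra njp1 => /eqP <-.
    have jSp : j.+1 = p by rewrite jp1 prednK.
    rewrite jSp eqxx it jSp up.
    have d0 : (0 < expansion b j)%N.
      rewrite lt0n; apply/eqP => d0; have := it j; rewrite d0 jSp up.
      rewrite /branch peak0 mulr0 subr0 => uj.
      by have := offset_bounds b j; rewrite uj ltxx andbF.
    by rewrite branch1 prednK // /branch mulr0 subr0.
  - move=> i; rewrite /T -(@odd_mod i p.+1); last by rewrite /= op.
    have : (i %% p.+1 < p.+1)%N by rewrite ltn_pmod.
    move: (i %% p.+1)%N => j jp; case: (eqVneq j p) => [->|njp].
      by rewrite op ltr01 lexx.
    have /andP[uj uj1] := offset_bounds b j.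
    case: ifP => oj; last by rewrite uj uj1.
    have jp' : (j < p)%N by rewrite ltn_neqAle njp -ltnS.
    by rewrite un ?(ltW uj1) // jp' andbT lt0n; apply: contraTneq oj => ->.
exists (offset b); split => // i; have /andP[ui ui1] := offset_bounds b i.
case: ifP => oi; last by rewrite ui ui1.
rewrite (ltW ui1) andbT lt_neqAle ui andbT eq_sym; apply/eqP => ui0.
have i0 : (0 < i)%N by rewrite lt0n; apply: contraTneq oi => ->.
apply: ne.
have ex : exists p, (0 < p)%N && (offset b p == 0) by exists i; rewrite i0 ui0 eqxx.
have := @erefl _ (ex_minn ex); case: {2}_ / ex_minnP => p /andP[p0 /eqP up] pmin _.
have [per uper] := offset_period p0 up.
exists p; split; last first.
  split => // q perq; apply: pmin; rewrite (proj1 perq) /=; apply/eqP.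
  exact: period_offset.
have umod n r : offset b (r + n * p) = offset b r.
  elim: n r => [|n IHn] r; first by rewrite mul0n addn0.
  by rewrite mulSn addnC -addnA [(n * p + r)%N]addnC addnC uper.
have pdvd : (p %| i)%N.
  rewrite /dvdn; apply: contraT; rewrite -lt0n => r0.
  have := pmin (i %% p)%N; rewrite r0 -(umod (i %/ p)%N) addnC -divn_eq ui0 eqxx.
  by move=> /(_ isT); rewrite leqNgt ltn_pmod.
exact: dvdn_odd pdvd oi.
Qed.
End Expansion.

(** * The map Upsilon *)

Lemma iter_phi_word_cat (n : nat) (v w : seq nat) :
  iter n phi_word (v ++ w) = iter n phi_word v ++ iter n phi_word w.
Proof. by elim: n => //= n ->; exact: phi_word_cat. Qed.

Lemma size_u_v_ (n : nat) :
  size (u_ n) = (expo n.+1).1 /\ size (v_ n) = (expo n.+1).2.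
Proof.
elim: n => [//|n [szu szv]]; split.
  rewrite /u_ iterSr (_ : phi_word _ = [:: 1%N] ++ [:: 0%N; 0%N]) //.
  by rewrite iter_phi_word_cat size_cat szu szv.
rewrite /v_ iterSr (_ : phi_word _ = [:: 1%N] ++ [:: 1%N]) //.
by rewrite iter_phi_word_cat size_cat szu /= addnn.
Qed.

Section Cells.
Variable R : realType.
Implicit Types (x y z : R) (m n : nat).

Lemma gammaP n : 0 < gamma_ R n /\
  upow n.+1 (gamma_ R n)^-1 + vpow n.+1 (gamma_ R n)^-1 = 1.
Proof.
have [szu szv] := size_u_v_ n.
have E (g : R) : g ^- size (u_ n) + g ^- size (v_ n) = upow n.+1 g^-1 + vpow n.+1 g^-1.
  by rewrite szu szv /upow /vpow !exprVn.
have ex : exists g : R, 0 < g /\ 1 = g ^- size (u_ n) + g ^- size (v_ n).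
  have [z /andP[z0 _] e] := @cell_right_end R n.
  by exists z^-1; rewrite invr_gt0 z0 E invrK e.
by have [g0 ->] := xgetPex 0 ex; rewrite E.
Qed.

Lemma gamma_lt n z : 0 < z ->
  ((gamma_ R n)^-1 < z) = (1 < upow n.+1 z + vpow n.+1 z).
Proof.
move=> z0; have [g0 gE] := gammaP n; have gV : 0 < (gamma_ R n)^-1 by rewrite invr_gt0.
rewrite -gE; apply/idP/idP; first exact: uvpow_mono (ltW gV).
apply: contraTT; rewrite -!leNgt le_eqVlt => /predU1P[->//|lt].
by rewrite ltW // uvpow_mono // ltW.
Qed.

Lemma oppV_mono x x' : x < 0 -> x' < 0 -> x < x' -> - x^-1 < - x'^-1.
Proof. by move=> x0 x'0 lt; rewrite -!invrN ltf_pV2 ?posrE ?oppr_gt0 // ltrN2. Qed.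

Lemma lt_oppV g x : x < 0 -> 0 < g -> (- g < x) = (g^-1 < - x^-1).
Proof. by move=> x0 g0; rewrite ltrNl -invrN ltf_pV2 // posrE oppr_gt0. Qed.

Lemma oppVK z : - (- z^-1)^-1 = z.
Proof. by rewrite invrN opprK invrK. Qed.

Lemma J_cell n x : J_ n x <-> x < 0 /\ cell n.+1 (- x^-1).
Proof.
rewrite /J_ /= in_itv /=; have [g0 _] := gammaP n; have [h0 _] := gammaP n.+1.
split=> [/andP[lo hi]|[x0 [z0 lo hi]]].
  have x0 : x < 0 by lra.
  have z0 : 0 < - x^-1 by rewrite oppr_gt0 invr_lt0.
  by split => //; split => //; rewrite ?leNgt -gamma_lt // -lt_oppV // -leNgt.
by rewrite lt_oppV // gamma_lt // lo leNgt lt_oppV // gamma_lt // -leNgt.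
Qed.

Lemma C_cell y : y \in `]-oo, - gamma_ R 0] <-> y < 0 /\ cell 0 (- y^-1).
Proof.
rewrite in_itv /=; have [h0 _] := gammaP 0.
split=> [hi|[y0 [z0 lo hi]]].
  have y0 : y < 0 by lra.
  have z0 : 0 < - y^-1 by rewrite oppr_gt0 invr_lt0.
  split => //; split => //; first by rewrite /upow /vpow /= expr0 expr1; lra.
  by rewrite leNgt -gamma_lt // -lt_oppV // -leNgt.
by rewrite leNgt lt_oppV // gamma_lt // -leNgt.
Qed.

Lemma cell_param m x : x < 0 -> cell m (- x^-1) -> x < -1.
Proof.
move=> x0 /cell_lt1; rewrite -invrN invf_lt1 ?oppr_gt0 //; lra.
Qed.

Lemma uvpow_le1S m z : 0 < z -> upow m z + vpow m z <= 1 -> upow m.+1 z + vpow m.+1 z <= 1.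
Proof.
move=> z0 le; rewrite uvpowS.
have X0 : 0 <= upow m z by rewrite exprn_ge0 // ltW.
have Y0 : 0 <= vpow m z by rewrite exprn_ge0 // ltW.
nra.
Qed.

Lemma cell_inj m m' z : cell m z -> cell m' z -> m = m'.
Proof.
have mono (i j : nat) : (i < j)%N -> 0 < z -> upow i.+1 z + vpow i.+1 z <= 1 -> upow j z + vpow j z <= 1.
  move=> /subnK <- z0 le; elim: (_ - _)%N => // n; rewrite addSn; exact: uvpow_le1S.
move=> [z0 lo hi] [_ lo' hi']; have [lt|lt|//] := ltngtP m m'.
  by have := mono _ _ lt z0 hi; rewrite leNgt lo'.
by have := mono _ _ lt z0 hi'; rewrite leNgt lo.
Qed.

Lemma expo_ge m : (m <= (expo m).1)%N.
Proof.
suff : (m <= (expo m).1)%N && ((0 < m) ==> (0 < (expo m).2))%N by case/andP.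
elim: m => [//|m /andP[IH1 IH2]]; rewrite /= double_gt0 expo_gt0 andbT.
case: m IH1 IH2 => [//|m] IH1 /= IH2.
by rewrite -addn1 leq_add.
Qed.

Lemma cell_exists z : 0 < z -> z < 1 -> 1 < upow 1 z + vpow 1 z -> exists n, cell n.+1 z.
Proof.
move=> z0 z1 lo.
have ex : exists m, upow m z + vpow m z <= 1.
  have c : z ^+ n @[n --> \oo] --> (0 : R) by apply: cvg_expr; rewrite gtr0_norm.
  have h0 : 0 < 2^-1 :> R by rewrite invr_gt0.
  have [m _ /(_ m (leqnn m)) /= zm] := cvgr_lt _ c _ h0.
  exists m.+1; rewrite uvpowS.
  have /andP[X0 _] := upow_bounds m z0 z1; have /andP[Y0 Y1] := vpow_bounds m z0 z1.
  have : upow m z <= z ^+ m by apply: ler_wiXn2l; rewrite ?expo_ge // ltW.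
  have : 2 * 2^-1 = 1 :> R by rewrite divff.
  by nra.
have := @erefl _ (ex_minn ex); case: {2}_ / ex_minnP => m le mmin _.
case: m le mmin => [|[|n]] le mmin.
- by move: le; rewrite /upow /vpow /= expr0 expr1; lra.
- by move: lo; rewrite ltNge le.
- exists n; split => //; rewrite ltNge; apply/negP => /mmin; by rewrite ltnn.
Qed.

Lemma cell_mono m z z' k k' t t' : cell m z -> cell m z' -> z < z' ->
  kneads (upow m z) (vpow m z) k t -> kneads (upow m z') (vpow m z') k' t' -> altlt k k'.
Proof.
move=> c c' zz; have [x0 x1 y0 y1 _] := cell_bounds c.
have [_ x'1 _ y'1 xy'] := cell_bounds c'; have [z0 _ _] := c.
by apply: kneads_mono => //; [exact: upow_mono (ltW z0) zz|exact: vpow_mono (ltW z0) zz].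
Qed.

Lemma cell_kneads n z : cell n.+1 z -> exists k t, kneads (upow n.+1 z) (vpow n.+1 z) k t.
Proof.
move=> c; have [x0 x1 y0 y1 _] := cell_bounds c; have [z0 lo _] := c.
apply: kneads_exists => //; rewrite exprn_ilt1 ?(cell_lt1 c) ?(ltW z0) //.
by rewrite /= -lt0n double_gt0 expo_gt0.
Qed.

Lemma charseq_kneads0 y : y < -1 ->
  exists t, kneads (upow 0 (- y^-1)) (vpow 0 (- y^-1)) (charseq y) t.
Proof. by move=> /kneads_charseq[t K]; exists t; move: K; rewrite /upow /vpow /= expr1 expr0. Qed.

Lemma charseqE m x k t : x < 0 -> cell m (- x^-1) ->
  kneads (upow m (- x^-1)) (vpow m (- x^-1)) k t -> charseq x = iter m phi_seq k.
Proof.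
move=> x0 c /[dup] K; have [z0 _ _] := c.
move=> /(kneads_iter_phi z0 (cell_lt1 c))[t' K'].
have [t'' K''] := kneads_charseq (cell_param x0 c).
by apply/funext; have [] := kneads_uniq z0 ltr01 K'' K'.
Qed.

(** The third clause is what later lemmas use: the characteristic sequence of
    Upsilon(x) is the kneading sequence at level n + 1 for the parameter of x. *)
Lemma UpsilonP n x : J_ n x ->
  [/\ Upsilon x \in `]-oo, - gamma_ R 0],
      charseq x =1 iter n.+1 phi_seq (charseq (Upsilon x)) &
      exists t, kneads (upow n.+1 (- x^-1)) (vpow n.+1 (- x^-1)) (charseq (Upsilon x)) t].
Proof.
move=> /[dup] Jx /J_cell[x0 c]; have [k [t K]] := cell_kneads c.
have xE := charseqE x0 c K.
have ex : exists y : R, y \in `]-oo, - gamma_ R 0] /\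
    exists2 n : nat, J_ n x & charseq x =1 iter n.+1 phi_seq (charseq y).
  have [z [t' [c' K']]] := cell_transfer 0 c K; have [z0 _ _] := c'.
  have zE := oppVK z.
  have y0 : - z^-1 < 0 by rewrite oppr_lt0 invr_gt0.
  exists (- z^-1); split; first by apply/C_cell; rewrite zE.
  exists n => // i; rewrite xE.
  have c'' : cell 0 (- (- z^-1)^-1) by rewrite zE.
  have [t'' K''] := charseq_kneads0 (cell_param y0 c'').
  rewrite zE in K''.
  have [x'0 _ y'0 _ _] := cell_bounds c'.
  by have [/funext -> _] := kneads_uniq x'0 y'0 K'' K'.
have [yC [n' Jx' e]] := xgetPex 0 ex.
have nn : n' = n.
  by have /J_cell[_ c'] := Jx'; have [] := cell_inj c c'.
rewrite nn in e; split => //; exists t.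
suff <- : k = charseq (Upsilon x) by [].
by apply/funext; apply: (@iter_phi_seq_inj n.+1) => i; rewrite -xE e.
Qed.

Lemma Upsilon_mono n x x' : J_ n x -> J_ n x' -> x < x' -> Upsilon x < Upsilon x'.
Proof.
move=> Jx Jx' lt; have [yC _ [t K]] := UpsilonP Jx; have [y'C _ [t' K']] := UpsilonP Jx'.
have /J_cell[x0 c] := Jx; have /J_cell[x'0 c'] := Jx'.
have kk := cell_mono c c' (oppV_mono x0 x'0 lt) K K'.
rewrite ltNge le_eqVlt; apply/negP => /predU1P[e|lt'].
  by rewrite e in kk; exact: (altlt_asym kk kk).
have /C_cell[y0 d] := yC; have /C_cell[y'0 d'] := y'C.
have [s Ks] := charseq_kneads0 (cell_param y0 d).
have [s' Ks'] := charseq_kneads0 (cell_param y'0 d').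
exact: (altlt_asym kk (cell_mono d' d (oppV_mono y'0 y0 lt') Ks' Ks)).
Qed.

(** The preimage is found by transferring the sequence of y to level n + 1; that
    its image is y follows from monotonicity at level 0. *)
Lemma Upsilon_surj n y : y \in `]-oo, - gamma_ R 0] -> exists2 x, J_ n x & Upsilon x = y.
Proof.
move=> /[dup] yC /C_cell[y0 d]; have [s Ks] := charseq_kneads0 (cell_param y0 d).
have [z [t [c K]]] := cell_transfer n.+1 d Ks; have [z0 _ _] := c.
have zE := oppVK z.
have Jx : J_ n (- z^-1) by apply/J_cell; rewrite zE oppr_lt0 invr_gt0.
exists (- z^-1) => //; have [y'C _ [t' K']] := UpsilonP Jx.
rewrite zE in K'; have [x0 _ yy0 _ _] := cell_bounds c.
have [/funext ek _] := kneads_uniq x0 yy0 K' K.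
have /C_cell[y'0 d'] := y'C; have [s' Ks'] := charseq_kneads0 (cell_param y'0 d').
have [lt|lt|//] := ltgtP (Upsilon (- z^-1)) y.
  have kk := cell_mono d' d (oppV_mono y'0 y0 lt) Ks' Ks.
  by rewrite ek in kk; case: (altlt_asym kk kk).
have kk := cell_mono d d' (oppV_mono y0 y'0 lt) Ks Ks'.
by rewrite ek in kk; case: (altlt_asym kk kk).
Qed.

Lemma Upsilon_continuous n : {within @J_ R n, continuous (@Upsilon R)}.
Proof.
apply/subspace_continuousP => x0 Jx0; apply/cvgrPdist_lt => e e0.
have [y0C _ _] := UpsilonP Jx0; have y0g := y0C; rewrite in_itv /= in y0g.
have le_mono x x' : J_ n x -> J_ n x' -> Upsilon x < Upsilon x' -> x < x'.
  move=> Jx Jx' lt; rewrite ltNge le_eqVlt; apply/negP => /predU1P[E|].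
    by rewrite E ltxx in lt.
  by move=> /(Upsilon_mono Jx' Jx); rewrite ltNge ltW.
have lowC : Upsilon x0 - e \in `]-oo, - gamma_ R 0] by rewrite in_itv /=; lra.
have [x1 Jx1 x1E] := Upsilon_surj n lowC.
have x10 : x1 < x0 by apply: le_mono => //; rewrite x1E; lra.
have [y0max|/eqP y0max] := eqVneq (Upsilon x0) (- gamma_ R 0).
  rewrite near_withinE; near=> x => Jx.
  have : Upsilon x1 < Upsilon x.
    by apply: (Upsilon_mono Jx1 Jx); near: x; exact: lt_nbhsr.
  have [xC _ _] := UpsilonP Jx; rewrite in_itv /= in xC.
  by rewrite x1E ltr_norml /from_subspace; lra.
pose y2 := Num.min (Upsilon x0 + e) (- gamma_ R 0).
have y20 : Upsilon x0 < y2 by rewrite lt_min ltrDl e0 lt_neqAle y0g andbT; apply/eqP.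
have y2C : y2 \in `]-oo, - gamma_ R 0] by rewrite in_itv /= ge_min lexx orbT.
have [x2 Jx2 x2E] := Upsilon_surj n y2C.
have x02 : x0 < x2 by apply: le_mono => //; rewrite x2E.
rewrite near_withinE; near=> x => Jx.
have lo : Upsilon x1 < Upsilon x.
  by apply: (Upsilon_mono Jx1 Jx); near: x; exact: lt_nbhsr.
have hi : Upsilon x < Upsilon x2.
  by apply: (Upsilon_mono Jx Jx2); near: x; exact: lt_nbhsl.
have y2e : y2 <= Upsilon x0 + e by rewrite ge_min lexx.
by rewrite x1E in lo; rewrite x2E in hi; rewrite ltr_norml /from_subspace; lra.
Unshelve. all: by end_near.
Qed.
End Cells.

Theorem theorem2 (R : realType) :
  let D : set R := `] - gamma_ R 0, -1[%classic in
  let C : set R := `]-oo, - gamma_ R 0]%classic in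
  [/\ set_fun D C (@Upsilon R),
      forall (n : nat) (x : R), J_ n x ->
        charseq x =1 iter n.+1 phi_seq (charseq (Upsilon x)),
      set_surj D C (@Upsilon R) &
      forall n : nat,
        set_inj (@J_ R n) (@Upsilon R) /\
        {within @J_ R n, continuous (@Upsilon R)}].
Proof.
move=> D C; split.
- move=> x; rewrite /D /= in_itv /= => /andP[lo hi].
  have [g0 _] := gammaP R 0.
  have z0 : 0 < - x^-1 by rewrite oppr_gt0 invr_lt0; lra.
  have z1 : - x^-1 < 1 by rewrite -invrN invf_lt1; lra.
  have zlo : 1 < upow 1 (- x^-1) + vpow 1 (- x^-1).
    by rewrite -gamma_lt // -invrN ltf_pV2 ?posrE //; lra.
  have [n c] := cell_exists z0 z1 zlo.
  have Jx : J_ n x by apply/J_cell; split => //; lra.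
  by have [] := UpsilonP Jx.
- by move=> n x Jx; have [] := UpsilonP Jx.
- move=> y yC; have [x Jx <-] := Upsilon_surj 0 (yC : y \in `]-oo, - gamma_ R 0]).
  exists x => //; have /J_cell[x0 c] := Jx.
  move: Jx; rewrite /J_ /D /= !in_itv /= => /andP[-> _] /=; exact: cell_param c.
- move=> n; split; last exact: Upsilon_continuous.
  move=> x x' /set_mem Jx /set_mem Jx' e; have [lt|lt|//] := ltgtP x x'.
    by have := Upsilon_mono Jx Jx' lt; rewrite e ltxx.
  by have := Upsilon_mono Jx' Jx lt; rewrite e ltxx.
Qed.
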